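(* Let $X$ be a semi-equivelar toroidal map. Then there exists a covering $\eta : Y \to X$ where $Y$ is a vertex-transitive toroidal map.
   Context: All maps are polyhedral maps on closed surfaces: each face is an $n$-gon for some $n\ge 3$, and any two intersecting faces meet in a single vertex or a single edge. A toroidal map is a map on the torus. For maps $X,Y$, a covering (polyhedral covering) $\eta:Y\to X$ is a surjection that preserves adjacency and sends vertices, edges and faces of $Y$ to vertices, edges and faces of $X$ respectively; an isomorphism is an injective covering, and isomorphic maps are identified. For a vertex $u$ of a map, the faces containing $u$ form a cycle $C_u$ (the face-cycle at $u$) of the form $(F_{1,1}\text{-}\cdots\text{-}F_{1,n_1})\text{-}\cdots\text{-}(F_{k,1}\text{-}\cdots\text{-}F_{k,n_k})\text{-}F_{1,1}$ where each $F_{i,j}$ is a $p_i$-gon and $p_i\ne p_{i+1}$ (indices mod $k$); the vertex-type of $u$ is $[p_1^{n_1},\dots,p_k^{n_k}]$, identified up to cyclic shift and reversal. A map is semi-equivelar if all its vertices have the same vertex-type. A map $M$ is vertex-transitive if its automorphism group $\mathrm{Aut}(M)$ acts transitively on its vertex set. *)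

(* Defs.v *)
From mathcomp Require Import all_boot all_algebra.

Set Implicit Arguments.
Unset Strict Implicit.
Unset Printing Implicit Defensive.

(* A polyhedral map is represented by its cell structure over a finite vertex
   type V.  Two faces meeting in more than one vertex share an edge, so the
   underlying graph has no multiple edges: an edge is the set of its two ends
   and a face is the set of the edges of its boundary cycle. *)
Notation edge_of V := {set V}.
Notation face_of V := {set {set V}}.

Definition polygon (V : finType) (s : seq V) : face_of V :=
  [set [set x; next s x] | x in s].

(* The number of sides of a face F is #|F| and its vertex set is cover F. *)
Definition is_polygon (V : finType) (F : face_of V) : Prop :=
  exists s : seq V, [/\ 3 <= size s, uniq s & F = polygon s].

Definition edge_set (V : finType) (K : {set face_of V}) : {set edge_of V} :=
  cover K.

Definition vertex_adj (V : finType) (K : {set face_of V}) : rel V :=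
  [rel u v | (u != v) && ([set u; v] \in edge_set K)].

Definition edge_adj (V : finType) : rel (edge_of V) :=
  [rel e f : edge_of V | (e != f) && (e :&: f != set0)].

Definition face_adj (V : finType) : rel (face_of V) :=
  [rel F G : face_of V | (F != G) && (F :&: G != set0)].

Definition faces_at (V : finType) (K : {set face_of V}) (u : V) :
  {set face_of V} := [set F in K | u \in cover F].

Definition face_adj_at (V : finType) (u : V) : rel (face_of V) :=
  [rel F G : face_of V |
    (F != G) && [exists e : edge_of V, (e \in F :&: G) && (u \in e)]].

(* s lists C_u, from some first face and in one of the two directions. *)
Definition face_cycle (V : finType) (K : {set face_of V}) (u : V)
    (s : seq (face_of V)) : Prop :=
  [/\ s != [::], uniq s, s =i faces_at K u & cycle (face_adj_at u) s].

Definition meet_properly (V : finType) (F G : face_of V) : Prop :=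
  let I := cover F :&: cover G in #|I| = 1 \/ I \in F :&: G.

(* The last four conditions say that the faces form a cell decomposition of a
   connected closed surface. *)
Record polyhedral_map := PolyhedralMap {
  vertex :> finType;
  faces : {set face_of vertex};
  faces_polygon : forall F, F \in faces -> is_polygon F;
  faces_meet : forall F G, F \in faces -> G \in faces -> F != G ->
    cover F :&: cover G != set0 -> meet_properly F G;
  edge_two_faces : forall e, e \in edge_set faces ->
    #|[set F in faces | e \in F]| = 2;
  vertex_face_cycle : forall u, exists s, face_cycle faces u s;
  map_nonempty : 0 < #|vertex|;
  map_connected : forall u v, connect (vertex_adj faces) u v
}.

Definition edges (X : polyhedral_map) : {set edge_of X} := edge_set (faces X).

(* Every face can be given a cyclic direction so that the two faces at an edge
   traverse it in opposite directions. *)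
Definition orientable (X : polyhedral_map) : Prop :=
  exists o : face_of X -> seq X,
    (forall F, F \in faces X ->
       [/\ 3 <= size (o F), uniq (o F) & F = polygon (o F)]) /\
    (forall F G (u v : X), F \in faces X -> G \in faces X -> F != G ->
       u \in o F -> u \in o G -> next (o F) u = v -> next (o G) u <> v).

Definition euler_char (X : polyhedral_map) : int :=
  (Posz #|X| - Posz #|edges X| + Posz #|faces X|)%R.

(* The torus is the connected closed orientable surface of Euler
   characteristic 0. *)
Definition toroidal (X : polyhedral_map) : Prop :=
  orientable X /\ euler_char X = 0%R.

(* The type [p_1^{n_1}, ..., p_k^{n_k}] is written out with each p_i repeated
   n_i times.  A vertex has all the cyclic shifts and the reversals of its type,
   since its face-cycle may be listed from any face and in both directions. *)
Definition has_vertex_type (X : polyhedral_map) (u : X) (t : seq nat) : Prop :=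
  exists2 s, face_cycle (faces X) u s & t = [seq #|F : face_of X| | F <- s].

Definition semi_equivelar (X : polyhedral_map) : Prop :=
  exists t : seq nat, forall u : X, has_vertex_type u t.

Definition edge_image (V W : finType) (eta : V -> W) (e : edge_of V) :
  edge_of W := [set eta x | x in e].

Definition face_image (V W : finType) (eta : V -> W) (F : face_of V) :
  face_of W := [set edge_image eta e | e in F].

(* Adjacent cells are distinct, so preserving the adjacency of edges and of
   faces makes eta injective on the star of each vertex; cov_gon excludes a face
   winding several times around its image. *)
Record covering (Y X : polyhedral_map) (eta : Y -> X) : Prop := Covering {
  cov_vertices : forall x : X, exists y : Y, eta y = x;
  cov_edges : [set edge_image eta e | e in edges Y] = edges X;
  cov_faces : [set face_image eta F | F in faces Y] = faces X;
  cov_gon : forall F, F \in faces Y -> #|face_image eta F| = #|F|;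
  cov_vertex_adj : forall u v : Y,
    vertex_adj (faces Y) u v -> vertex_adj (faces X) (eta u) (eta v);
  cov_edge_adj : forall e f, e \in edges Y -> f \in edges Y ->
    edge_adj e f -> edge_adj (edge_image eta e) (edge_image eta f);
  cov_face_adj : forall F G, F \in faces Y -> G \in faces Y ->
    face_adj F G -> face_adj (face_image eta F) (face_image eta G)
}.

Definition isomorphism (Y X : polyhedral_map) (eta : Y -> X) : Prop :=
  covering eta /\ injective eta.

Definition automorphism (X : polyhedral_map) (a : X -> X) : Prop :=
  isomorphism a.

Definition vertex_transitive (X : polyhedral_map) : Prop :=
  forall u v : X, exists2 a : X -> X, automorphism a & a u = v.

(* Main.v *)
(** The cover is built without a universal cover.  A flag is a chain
    vertex - edge - face, and the three flips (change the vertex, the edge or the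
    face) generate a finite permutation group [G] of the flags of [X].  Suppose
    the flags are labelled so that the label of a flag determines the labels of
    its flips and the size of its face, and so that some label [l] occurs at
    every vertex.  Let [A] be the set of flags with label [l].  The restrictions
    to [A] of the elements of [G] are the flags of a map [Y], because elements
    acting around a vertex or around a face fix all flags of equal label as soon
    as they fix one.  Evaluation at a flag of [A] covers [X], and precomposition
    with the elements of [G] that preserve [A] acts on [Y] transitively on the
    vertices.

    It remains to label the flags.  The word of a flag lists the sizes of the
    faces around its vertex, read from its face away from its edge; flips of edge
    and face act on words by rotation and reversal.  Since the Euler
    characteristic is 0, [d/2 - 1 = 1/p_1 + ... + 1/p_d], which leaves few types
    with [d > 3].  The word of a flag and that of its vertex flip agree in their
    first and last entries; together with the compatibility of the words at the
    corners of a triangle, and with the fact that all words are equally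
    frequent, this makes words a good labelling except for the type [3^4, 6],
    where the word has to be completed by a chirality. *)

Require Import Defs.
From mathcomp Require Import all_boot all_order all_algebra all_fingroup.
From mathcomp Require Import lra.

Set Implicit Arguments.
Unset Strict Implicit.
Unset Printing Implicit Defensive.

(** * Polygons *)

Section Other.
Variable T : finType.
Implicit Types (S : {set T}) (a b : T).

(** The swap of the two elements of a two-element set, from which all three flips are made. The
    default [a] only matters when [S] has no second element. *)
Definition other S a : T := odflt a [pick b in S :\ a].

Lemma otherP S a : #|S| = 2 -> a \in S ->
  [/\ other S a \in S, other S a != a &
      forall b, b \in S -> b != a -> b = other S a].
Proof.
move=> S2 aS; have /cards1P[c Sc] : #|S :\ a| == 1.
  by have := cardsD1 a S; rewrite S2 aS add1n => -[<-].
have cP b : (b != a) && (b \in S) = (b == c) by rewrite -in_setD1 Sc inE.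
have oc : other S a = c.
  rewrite /other; case: pickP => [b|/(_ c)]; first by rewrite Sc inE => /eqP.
  by rewrite Sc inE eqxx.
have /andP[ca cS] : (c != a) && (c \in S) by rewrite cP.
by rewrite oc; split=> // b bS ba; apply/eqP; rewrite -cP ba.
Qed.

Lemma otherK S a : #|S| = 2 -> a \in S -> other S (other S a) = a.
Proof.
move=> S2 aS; have [oS oa _] := otherP S2 aS.
by have [_ _ /(_ a aS)] := otherP S2 oS; rewrite eq_sym => /(_ oa).
Qed.

Lemma set2_other S a : #|S| = 2 -> a \in S -> S = [set a; other S a].
Proof.
move=> S2 aS; have [oS oa oP] := otherP S2 aS.
apply/setP=> b; rewrite !inE; apply/idP/orP => [bS | [] /eqP-> //].
by have [->|/oP ba] := eqVneq b a; [left | right; apply/eqP/ba].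
Qed.

Lemma other_set2 a b : a != b -> other [set a; b] a = b.
Proof.
move=> ab; have S2 : #|[set a; b]| = 2 by rewrite cards2 ab.
have [_ _ oP] := otherP S2 (set21 a b).
by rewrite -(oP b) ?set22 // eq_sym.
Qed.

Lemma set2_inj a b b' : [set a; b] = [set a; b'] -> b = b'.
Proof.
move=> E; have : b \in [set a; b'] by rewrite -E set22.
have : b' \in [set a; b] by rewrite E set22.
by rewrite !inE => /orP[] /eqP-> // /orP[] /eqP->.
Qed.
End Other.

Section Polygon.
Variable V : finType.
Implicit Types (s : seq V) (x y : V).

(** Listing a cycle as the values of [h] with [h n = h 0] turns [next] into the successor, the
    wrap-around included. *)
Lemma next_mkseq (h : nat -> V) n i : uniq (mkseq h n) -> h n = h 0 ->
  i < n -> next (mkseq h n) (h i) = h i.+1.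
Proof.
case: n => // n U hn ilt.
have hin : h i \in mkseq h n.+1 by apply: map_f; rewrite mem_iota.
rewrite next_nth hin /= -/(mkseq _ _).
have hi : h i = nth (h 0) (mkseq h n.+1) i by rewrite nth_mkseq.
have := index_uniq (h 0) _ U; move=> /(_ i); rewrite size_mkseq ilt => /(_ isT).
rewrite -hi /= => ->.
move: ilt; rewrite ltnS leq_eqVlt => /orP[/eqP->|lt].
  by rewrite nth_default ?size_map ?size_iota.
by rewrite (nth_map 0) ?size_iota // nth_iota.
Qed.

Lemma polygon_mkseq (h : nat -> V) n : uniq (mkseq h n) -> h n = h 0 ->
  polygon (mkseq h n) = [set [set h i; h i.+1] | i : 'I_n].
Proof.
move=> U hn; apply/setP=> e; apply/imsetP/imsetP => [[x]|[i _ ->]].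
  case/mapP=> i; rewrite mem_iota => /= ilt -> ->.
  by exists (Ordinal ilt) => //=; rewrite next_mkseq.
exists (h i); last by rewrite next_mkseq.
by rewrite map_f // mem_iota /= ltn_ord.
Qed.

Lemma next_neq s x : uniq s -> 3 <= size s -> x \in s ->
  (next s x != x) * (next s (next s x) != x).
Proof.
move=> U; case: (mkseqP x s) U => n h _; rewrite size_mkseq.
move=> U n3 /mapP[i]; rewrite mem_iota add0n => /= ilt ->.
(* The periodic extension of [h] makes [next] the successor at every index. *)
pose h' i := h (i %% n).
have n0 : 0 < n by apply: leq_trans n3.
have E : mkseq h n = mkseq h' n.
  by apply/eq_in_map => j; rewrite mem_iota => /= jn; rewrite /h' modn_small.
have hE : h i = h' i by rewrite /h' modn_small.
rewrite hE E; rewrite E in U.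
have h'n : h' n = h' 0 by rewrite /h' modnn mod0n.
have hm j : h' (j %% n) = h' j by rewrite /h' modn_mod.
have nx j : next (mkseq h' n) (h' j) = h' j.+1.
  rewrite -hm next_mkseq ?ltn_pmod //; rewrite -(hm (_).+1) -(hm j.+1).
  by rewrite -addn1 modnDml addn1.
rewrite !nx; have /mkseq_uniqP inj := U.
have neq k : 0 < k < n -> h' (i + k) != h' i.
  move=> /andP[k0 kn]; apply/eqP; rewrite -(hm (i + k)) => /inj.
  rewrite !inE ltn_pmod // ilt => /(_ isT isT) E2.
  have : i + k == i + 0 %[mod n] by rewrite E2 addn0 modn_small.
  by rewrite eqn_modDl mod0n modn_small // eqn0Ngt k0.
by rewrite -addn1 neq ?n0 ?(ltn_trans _ n3) // -[_.+1]addn1 -addnA neq // ltnW.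
Qed.

Lemma polygon_rot s n : uniq s -> polygon (rot n s) = polygon s.
Proof.
move=> U; apply/setP=> e; apply/imsetP/imsetP => -[x xs ->]; exists x;
  by rewrite ?next_rot // ?mem_rot // -(mem_rot n).
Qed.

Lemma polygon_rev s : uniq s -> polygon (rev s) = polygon s.
Proof.
move=> U; apply/setP=> e; apply/imsetP/imsetP => -[x xs ->].
  exists (prev s x); first by rewrite mem_prev -mem_rev.
  by rewrite next_rev // next_prev // setUC.
exists (next s x); first by rewrite mem_rev mem_next.
by rewrite next_rev // prev_next // setUC.
Qed.

Lemma mkseq_periodic s : uniq s -> s != [::] ->
  exists h n, [/\ s = mkseq h n, h n = h 0 & 0 < n].
Proof.
case: s => // x s U _; exists (fun i => nth x (x :: s) (i %% size (x :: s))).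
exists (size (x :: s)); split=> //; last by rewrite modnn mod0n.
rewrite -{1}[x :: s](mkseq_nth x); apply/eq_in_map => i; rewrite mem_iota /=.
by move=> ilt; rewrite modn_small.
Qed.

Lemma cover_polygon s : cover (polygon s) = [set x in s].
Proof.
apply/setP=> x; rewrite inE; apply/bigcupP/idP => [[_ /imsetP[y ys ->]]|xs].
  by rewrite !inE => /orP[] /eqP->; rewrite ?mem_next.
by exists [set x; next s x]; [apply: imset_f | rewrite set21].
Qed.

Lemma card_polygon_edge s e : uniq s -> 3 <= size s -> e \in polygon s ->
  #|e| = 2.
Proof.
move=> U s3 /imsetP[x xs ->]; rewrite cards2.
by rewrite eq_sym next_neq.
Qed.

Lemma card_polygon s : uniq s -> 3 <= size s -> #|polygon s| = size s.
Proof.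
move=> U s3; rewrite card_in_imset; first exact/card_uniqP.
move=> x y xs ys E.
have : x \in [set y; next s y] by rewrite -E set21.
rewrite !inE => /orP[/eqP//|/eqP xE].
have : y \in [set x; next s x] by rewrite E set21.
rewrite !inE => /orP[/eqP//|/eqP yE].
by have := (next_neq U s3 ys).2; rewrite -xE -yE eqxx.
Qed.

Lemma card_polygon_cover s : uniq s -> 3 <= size s ->
  #|cover (polygon s)| = #|polygon s|.
Proof.
by move=> U s3; rewrite card_polygon // cover_polygon cardsE; apply/card_uniqP.
Qed.

Lemma polygon_edges_at s x : uniq s -> x \in s ->
  [set e in polygon s | x \in e] = [set [set x; next s x]; [set x; prev s x]].
Proof.
move=> U xs; apply/setP=> e; rewrite !inE; apply/andP/orP.
  case=> /imsetP[y ys ->]; rewrite !inE => /orP[] /eqP->; first by left.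
  by right; rewrite prev_next // setUC.
case=> /eqP->; rewrite set21; split=> //; first exact: imset_f.
apply/imsetP; exists (prev s x); first by rewrite mem_prev.
by rewrite next_prev // setUC.
Qed.

Lemma card_polygon_edges_at s x : uniq s -> 3 <= size s -> x \in s ->
  #|[set e in polygon s | x \in e]| = 2.
Proof.
move=> U s3 xs; rewrite polygon_edges_at // cards2.
suff -> : [set x; next s x] != [set x; prev s x] by [].
apply/eqP => /set2_inj E; have := (next_neq U s3 xs).2.
by rewrite E next_prev // eqxx.
Qed.

(* A walk [h] around the polygon, from any given vertex and towards any given
   side, of which [mkseq h n] is one turn. *)
Lemma is_polygon_walk (F : face_of V) (e : edge_of V) x : is_polygon F ->
  e \in F -> x \in e ->
  exists h n, [/\ [/\ 3 <= n, uniq (mkseq h n) & h n = h 0],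
    F = polygon (mkseq h n), h 0 = x & e = [set h 0; h 1]].
Proof.
case=> s [s3 U ->] eF xe.
have {eF} [z zs eE] := imsetP eF.
wlog zx : s s3 U z zs eE / z = x => [W|].
  move: (xe); rewrite {1}eE !inE => /orP[] /eqP xz; first exact: (W s s3 U z zs eE (esym xz)).
  rewrite -(polygon_rev U).
  apply: (W _ _ _ x); rewrite ?size_rev ?rev_uniq // ?mem_rev ?xz ?mem_next //.
  by rewrite next_rev // prev_next // setUC.
subst z; have [i s' E] := rot_to zs.
have s'U : uniq (x :: s') by rewrite -E rot_uniq.
have [h [n [hE hn n0]]] := mkseq_periodic s'U isT.
have h0 : h 0 = x by case: n n0 hE {hn} => // n _ [].
have n3 : 3 <= n by rewrite -(size_mkseq h n) -hE -E size_rot.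
exists h, n; split=> //; rewrite -?hE //.
- by rewrite -E polygon_rot.
- by rewrite eE -(@next_mkseq h n) -?hE // -E next_rot // h0.
Qed.
End Polygon.

(** * Images of polygons under maps of the vertices *)

Section PolygonMap.
Variables V W : finType.

Lemma polygon_map (g : V -> W) (s : seq V) : uniq s ->
  {in s &, injective g} -> polygon (map g s) = face_image g (polygon s).
Proof.
have [->|s0] := eqVneq s [::].
  move=> _ _; apply/setP=> e; apply/imsetP/imsetP=> -[x]; first by [].
  by case/imsetP.
move=> U inj; have [h [n [E hn n0]]] := mkseq_periodic U s0; subst s.
have E : map g (mkseq h n) = mkseq (g \o h) n by rewrite /mkseq -map_comp.
have U' : uniq (mkseq (g \o h) n) by rewrite -E map_inj_in_uniq.
rewrite E !polygon_mkseq //=; last by rewrite hn.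
rewrite /face_image -imset_comp; apply: eq_imset => i /=.
by rewrite /edge_image imsetU !imset_set1.
Qed.

Lemma edge_image2 (g : V -> W) x y : edge_image g [set x; y] = [set g x; g y].
Proof. by rewrite /edge_image imsetU !imset_set1. Qed.

Lemma cover_image (g : V -> W) (F : face_of V) :
  cover (face_image g F) = g @: cover F.
Proof.
apply/setP=> y; apply/bigcupP/imsetP => [[_ /imsetP[e eF ->] /imsetP[x xe ->]]|].
  by exists x => //; apply/bigcupP; exists e.
case=> x /bigcupP[e eF xe] ->; exists (edge_image g e); first exact: imset_f.
exact: imset_f.
Qed.
End PolygonMap.

(** * Flags *)

Section Flags.
Variable X : polyhedral_map.
Implicit Types (x y : X) (e : edge_of X) (F G : face_of X).

Lemma face_edge2 F e : F \in faces X -> e \in F -> #|e| = 2.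
Proof. by case/faces_polygon=> s [s3 U ->]; apply: card_polygon_edge. Qed.

Lemma face_edges_at2 F e x : F \in faces X -> e \in F -> x \in e ->
  #|[set e' in F | x \in e']| = 2.
Proof.
case/faces_polygon=> s [s3 U ->] eF xe; apply: card_polygon_edges_at => //.
suff: x \in cover (polygon s) by rewrite cover_polygon inE.
by apply/bigcupP; exists e.
Qed.

Lemma edge_faces2 F e : F \in faces X -> e \in F ->
  #|[set F' in faces X | e \in F']| = 2.
Proof. by move=> FX eF; apply: edge_two_faces; apply/bigcupP; exists F. Qed.

Lemma card_cover_face F : F \in faces X -> #|cover F| = #|F|.
Proof. by case/faces_polygon=> s [s3 U ->]; apply: card_polygon_cover. Qed.

Definition is_flag (t : X * edge_of X * face_of X) :=
  [&& t.1.1 \in t.1.2, t.1.2 \in t.2 & t.2 \in faces X].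
Definition flag := {t | is_flag t}.
Implicit Types f g : flag.

Definition fvert f : X := (val f).1.1.
Definition fedge f : edge_of X := (val f).1.2.
Definition fface f : face_of X := (val f).2.

Lemma flagP f :
  [/\ fvert f \in fedge f, fedge f \in fface f & fface f \in faces X].
Proof. exact/and3P/(valP f). Qed.

Lemma flag_eq f g : fvert f = fvert g -> fedge f = fedge g ->
  fface f = fface g -> f = g.
Proof.
move=> Ev Ee Ef; apply: val_inj.
rewrite [val f]surjective_pairing [(val f).1]surjective_pairing.
rewrite [val g]surjective_pairing [(val g).1]surjective_pairing.
by congr (_, _, _).
Qed.

Lemma mk_flag x e F : x \in e -> e \in F -> F \in faces X ->
  exists f, [/\ fvert f = x, fedge f = e & fface f = F].
Proof.
move=> xe eF FX; have Pf : is_flag (x, e, F) by apply/and3P.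
by exists (Sub (x, e, F) Pf).
Qed.

Lemma flip0_subproof f :
  is_flag (other (fedge f) (fvert f), fedge f, fface f).
Proof.
have [xe eF FX] := flagP f; apply/and3P; split=> //=.
by have [] := otherP (face_edge2 FX eF) xe.
Qed.

Lemma flip1_subproof f : is_flag
  (fvert f, other [set e in fface f | fvert f \in e] (fedge f), fface f).
Proof.
have [xe eF FX] := flagP f.
have eS : fedge f \in [set e in fface f | fvert f \in e] by rewrite inE eF.
have [] := otherP (face_edges_at2 FX eF xe) eS.
by rewrite inE => /andP[? ?] _ _; apply/and3P.
Qed.

Lemma flip2_subproof f : is_flag
  (fvert f, fedge f, other [set F in faces X | fedge f \in F] (fface f)).
Proof.
have [xe eF FX] := flagP f.
have eS : fface f \in [set F in faces X | fedge f \in F] by rewrite inE FX.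
have [] := otherP (edge_faces2 FX eF) eS.
by rewrite inE => /andP[? ?] _ _; apply/and3P.
Qed.

(** An edge has two ends, a face has two edges at each of its vertices, and an edge lies on two
    faces: each of these gives one flip. *)
Definition flip0 f : flag := Sub _ (flip0_subproof f).
Definition flip1 f : flag := Sub _ (flip1_subproof f).
Definition flip2 f : flag := Sub _ (flip2_subproof f).

Lemma flip0K : involutive flip0.
Proof.
move=> f; have [xe eF FX] := flagP f.
by apply: flag_eq => //; apply: otherK (face_edge2 FX eF) xe.
Qed.

Lemma flip1K : involutive flip1.
Proof.
move=> f; have [xe eF FX] := flagP f; apply: flag_eq => //.
by apply: otherK (face_edges_at2 FX eF xe) _; rewrite inE eF.
Qed.

Lemma flip2K : involutive flip2.
Proof.
move=> f; have [xe eF FX] := flagP f; apply: flag_eq => //.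
by apply: otherK (edge_faces2 FX eF) _; rewrite inE FX.
Qed.

Lemma flip02 f : flip0 (flip2 f) = flip2 (flip0 f).
Proof. exact: flag_eq. Qed.

Lemma flip0_vert f : fvert (flip0 f) != fvert f.
Proof.
by have [xe eF FX] := flagP f; have [] := otherP (face_edge2 FX eF) xe.
Qed.

Lemma flip1_edge f : fedge (flip1 f) != fedge f.
Proof.
have [xe eF FX] := flagP f.
by have [] := otherP (face_edges_at2 FX eF xe) (_ : fedge f \in _);
  rewrite ?inE ?eF.
Qed.

Lemma flip2_face f : fface (flip2 f) != fface f.
Proof.
have [xe eF FX] := flagP f.
by have [] := otherP (edge_faces2 FX eF) (_ : fface f \in _);
  rewrite ?inE ?FX.
Qed.

Lemma fedgeE f : fedge f = [set fvert f; fvert (flip0 f)].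
Proof. by have [xe eF FX] := flagP f; apply: set2_other (face_edge2 FX eF) xe. Qed.

Lemma flag_vert_edge f g : fvert f = fvert g -> fedge f = fedge g ->
  g = f \/ g = flip2 f.
Proof.
move=> Ev Ee; have [E|NE] := eqVneq (fface g) (fface f).
  by left; apply: flag_eq.
right; apply: flag_eq => //; have [xe eF FX] := flagP f.
have fS : fface f \in [set F in faces X | fedge f \in F] by rewrite inE FX.
have [_ _ oP] := otherP (edge_faces2 FX eF) fS; apply: oP => //.
by have [_ egF gX] := flagP g; rewrite inE gX Ee.
Qed.

Lemma flag_vert_face f g : fvert f = fvert g -> fface f = fface g ->
  g = f \/ g = flip1 f.
Proof.
move=> Ev Ee; have [E|NE] := eqVneq (fedge g) (fedge f).
  by left; apply: flag_eq.
right; apply: flag_eq => //; have [xe eF FX] := flagP f.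
have fS : fedge f \in [set e in fface f | fvert f \in e] by rewrite inE eF.
have [_ _ oP] := otherP (face_edges_at2 FX eF xe) fS; apply: oP => //.
by have [vg egF gX] := flagP g; rewrite inE Ev Ee egF.
Qed.

(** [face_step] turns about the face and [vert_step] about the vertex, by one corner. *)
Definition face_step f := flip1 (flip0 f).
Definition vert_step f := flip2 (flip1 f).

Lemma face_step_next f (s : seq X) : uniq s -> 3 <= size s ->
  fvert f \in s -> fface f = polygon s ->
  fedge f = [set fvert f; next s (fvert f)] ->
  [/\ fvert (face_step f) = next s (fvert f),
      fface (face_step f) = polygon s &
      fedge (face_step f) = [set next s (fvert f); next s (next s (fvert f))]].
Proof.
move=> U s3 xs FE eE; set x := fvert f in xs eE *.
have xy : x != next s x by rewrite eq_sym next_neq.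
have vE : fvert (face_step f) = next s x.
  by rewrite -(other_set2 xy) -eE.
split=> //; have [] := flagP (face_step f).
set e' := fedge _; rewrite vE => ve eF _.
have : e' \in [set e in polygon s | next s x \in e].
  by rewrite inE ve -FE eF.
rewrite polygon_edges_at ?mem_next // !inE => /orP[/eqP//|].
rewrite prev_next // => /eqP E.
by have := flip1_edge (flip0 f); rewrite -/(face_step f) -/e' E setUC -eE eqxx.
Qed.

Lemma face_walk f (n := #|fface f|) (h := fun i => fvert (iter i face_step f)) :
  [/\ 3 <= n, uniq (mkseq h n), iter n face_step f = f &
      fface f = polygon (mkseq h n)].
Proof.
have [xe eF FX] := flagP f.
have [k [m [[m3 U km] FE k0 eE]]] := is_polygon_walk (faces_polygon FX) eF xe.
set s := mkseq k m in U FE; have s3 : 3 <= size s by rewrite size_mkseq.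
have nE : n = m by rewrite /n FE card_polygon // size_mkseq.
have m0 : 0 < m by apply: ltn_trans m3.
have xs : fvert f \in s by rewrite -k0 map_f // mem_iota.
have W i : [/\ h i = iter i (next s) (fvert f), fface (iter i face_step f) = polygon s
   & fedge (iter i face_step f) = [set h i; next s (h i)]].
  elim: i => [|i [hi Fi ei]] /=.
    by split=> //; rewrite eE -(next_mkseq U km m0) k0.
  have his : h i \in s.
    by rewrite hi; elim: (i) => //= j; rewrite mem_next.
  by have [E1 E2 ->] := face_step_next U s3 his Fi ei; rewrite /h /= E1 -hi.
have hk i : i <= m -> h i = k i.
  have [-> _ _] := W i; elim: i => [|i IH] /= im; first by rewrite k0.
  by rewrite IH ?(ltnW im) // next_mkseq.
have sE : mkseq h n = s.
  by rewrite nE; apply/eq_in_map=> i; rewrite mem_iota => /= im; rewrite hk // ltnW.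
rewrite sE nE; split=> //.
have [_ Fm em] := W m; have vm := hk m (leqnn m).
rewrite km k0 in vm; apply: flag_eq => //; last by rewrite Fm.
by rewrite em vm eE -k0 next_mkseq.
Qed.

Lemma face_step_free f i : iter i face_step f = f -> #|fface f| %| i.
Proof.
have [n3 /mkseq_uniqP inj fix_n _] := face_walk f; set n := #|_| in n3 inj fix_n *.
have n0 : 0 < n by apply: ltn_trans n3.
have fixM k : iter (k * n) face_step f = f.
  by elim: k => // k IH; rewrite mulSn addnC iterD fix_n.
rewrite (divn_eq i n) addnC iterD fixM => E.
rewrite dvdn_addl ?dvdn_mull //; have /inj : fvert (iter (i %% n) face_step f) = fvert (iter 0 face_step f) by rewrite E.
by rewrite !inE ltn_pmod // => /(_ isT n0) ->.
Qed.

(* [face_step] preserves the sense in which a flag runs around its face and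
   [flip0] reverses it. *)
Lemma flip0_face_step_free f i : iter i face_step f <> flip0 f.
Proof.
move=> E; have [n3 /mkseq_uniqP inj fix_n _] := face_walk f.
set n := #|_| in n3 inj fix_n.
have n0 : 0 < n by apply: ltn_trans n3.
have fixM k : iter (k * n) face_step f = f.
  by elim: k => // k IH; rewrite mulSn addnC iterD fix_n.
move: E; rewrite (divn_eq i n) addnC iterD fixM => E.
have /inj : fvert (iter (i %% n) face_step f) = fvert (iter 1 face_step f).
  by rewrite E.
rewrite !inE ltn_pmod // => /(_ isT (ltnW n3)) i1; move: E; rewrite i1 /= => E.
by have := flip1_edge (flip0 f); rewrite -/(face_step f) E eqxx.
Qed.

(** A common edge contributes two vertices to the intersection, so by [faces_meet] the intersection
    is an edge, and every common edge fills it. *)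
Lemma faces_share_edge F G e e' : F \in faces X -> G \in faces X -> F != G ->
  e \in F :&: G -> e' \in F :&: G -> e = e'.
Proof.
move=> FX GX FG /setIP[eF eG] /setIP[e'F e'G].
have [e2 e'2] := (face_edge2 FX eF, face_edge2 FX e'F).
have sub A : A \in F -> A \in G -> A \subset cover F :&: cover G.
  by move=> AF AG; apply/subsetIP; split; apply: bigcup_sup AF || apply: bigcup_sup AG.
have I0 : cover F :&: cover G != set0.
  apply: contraTneq (sub _ eF eG) => ->; rewrite subset0.
  by rewrite -cards_eq0 e2.
have [I1|/setIP[IF _]] := faces_meet FX GX FG I0.
  by have := subset_leq_card (sub _ eF eG); rewrite I1 e2.
have I2 := face_edge2 FX IF.
have EE A : A \in F -> A \in G -> A = cover F :&: cover G.
  move=> AF AG; apply/eqP; rewrite eqEcard (sub A) //= I2.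
  by rewrite (face_edge2 FX AF).
by rewrite (EE e) // (EE e').
Qed.

(** If the two neighbours of a face around a vertex coincided, they would share two edges with that
    face. *)
Lemma vert_step_face f : fface (vert_step f) != fface (flip2 f).
Proof.
have [xe eF FX] := flagP f; have [_ e2 F2] := flagP (flip2 f).
have [_ eV FV] := flagP (vert_step f).
apply: contraNneq (flip1_edge f) => E; apply/eqP.
apply: (@faces_share_edge (fface f) (fface (flip2 f))) => //.
- by rewrite eq_sym flip2_face.
- by rewrite inE -E [_ \in fface (vert_step _)]eV; have [_ -> _] := flagP (flip1 f).
- by rewrite inE eF [_ \in fface (flip2 _)]e2.
Qed.

Lemma face_adj_flip f G : G \in faces X -> face_adj_at (fvert f) (fface f) G ->
  G = fface (flip2 f) \/ G = fface (vert_step f).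
Proof.
move=> GX /andP[FG /existsP[e /andP[/setIP[eF eG] ve]]].
have [g [gv ge gF]] := mk_flag ve eF (let: And3 _ _ h := flagP f in h).
have [g' [gv' ge' gF']] := mk_flag ve eG GX.
have [E|E] := @flag_vert_edge g g' (etrans gv (esym gv')) (etrans ge (esym ge')).
  by rewrite -gF' E gF eqxx in FG.
by have [E2|E2] := @flag_vert_face f g (esym gv) (esym gF);
  [left | right]; rewrite -gF' E E2.
Qed.

Lemma face_adj_at_sym x : symmetric (@face_adj_at X x).
Proof. by move=> F G; rewrite /face_adj_at /= eq_sym setIC. Qed.

Lemma mem_faces_at f : fface f \in faces_at (faces X) (fvert f).
Proof.
have [xe eF FX] := flagP f; rewrite inE FX /=.
by apply/bigcupP; exists (fedge f).
Qed.

Lemma face_cycle_step f s : face_cycle (faces X) (fvert f) s ->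
  [/\ next s (fface f) = fface (vert_step f) & prev s (fface f) = fface (flip2 f)]
  \/ [/\ next s (fface f) = fface (flip2 f) & prev s (fface f) = fface (vert_step f)].
Proof.
case=> _ U sE sC.
have Fs : fface f \in s by rewrite sE mem_faces_at.
(* With at least three faces in the cycle, [next] and [prev] differ, so they are the two neighbours
   of the face in one order or the other. *)
have s3 : 3 <= size s.
  apply: (@uniq_leq_size _ [:: fface f; fface (flip2 f); fface (vert_step f)]).
    rewrite /= !inE negb_or eq_sym flip2_face.
    rewrite [_ == fface (vert_step f)]eq_sym (flip2_face (flip1 f)).
    by rewrite eq_sym vert_step_face.
  move=> G; rewrite !inE => /or3P[] /eqP-> //; rewrite sE; first exact: (mem_faces_at (flip2 f)).
  exact: (mem_faces_at (vert_step f)).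
have FsX G : G \in s -> G \in faces X by rewrite sE inE => /andP[].
have np : next s (fface f) != prev s (fface f).
  apply/eqP=> E; have := (next_neq U s3 Fs).2; rewrite E next_prev // eqxx.
  by [].
have nP := face_adj_flip (FsX _ _) (next_cycle sC Fs).
have pP := face_adj_flip (FsX _ _) (etrans (face_adj_at_sym _ _ _) (prev_cycle sC Fs)).
rewrite mem_next in nP; rewrite mem_prev in pP.
move: np; case: (nP Fs) => ->; case: (pP Fs) => ->; rewrite ?eqxx // => _.
  by right.
by left.
Qed.

Lemma fvert_iter i f : fvert (iter i vert_step f) = fvert f.
Proof. by elim: i => //= i <-. Qed.

(** The list cannot reverse its direction relative to [vert_step]: at a reversal the two neighbours
    of a face would coincide. *)
Lemma vert_walk_next f s : face_cycle (faces X) (fvert f) s ->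
  next s (fface f) = fface (vert_step f) ->
  forall i, next s (fface (iter i vert_step f)) = fface (iter i.+1 vert_step f).
Proof.
move=> sC E; have [_ U _ _] := sC; elim=> //= i IH.
have sC' : face_cycle (faces X) (fvert (iter i.+1 vert_step f)) s.
  by rewrite fvert_iter.
have [[]//|[_ pE]] := face_cycle_step sC'.
have := vert_step_face (iter i.+1 vert_step f); rewrite -pE /= -IH prev_next //.
by rewrite /vert_step flip2K /= eqxx.
Qed.

Definition vert_word d f := mkseq (fun i => #|fface (iter i vert_step f)|) d.

Lemma vertex_type_flag x t : has_vertex_type x t -> exists f,
  [/\ fvert f = x, iter (size t) vert_step f = f, vert_word (size t) f = t,
      uniq (mkseq (fun i => fface (iter i vert_step f)) (size t)) &
      mkseq (fun i => fface (iter i vert_step f)) (size t) =i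
      faces_at (faces X) x].
Proof.
case=> s sC ->; rewrite size_map; have [s0 U sE _] := sC.
have [h [n [hE hn n0]]] := mkseq_periodic U s0.
have h0s : h 0 \in s by rewrite hE map_f // mem_iota.
have := h0s; rewrite sE inE => /andP[h0X /bigcupP[e eh0 xe]].
have [f [fx fe fF]] : exists f, [/\ fvert f = x, fface f = h 0 & h 1 = fface (vert_step f)].
  have [f [fx fe fF]] := mk_flag xe eh0 h0X.
  have sCf : face_cycle (faces X) (fvert f) s by rewrite fx.
  have h1 : h 1 = next s (fface f) by rewrite fF hE next_mkseq -?hE.
  have [[E _]|[E _]] := face_cycle_step sCf; first by exists f; rewrite h1 E.
  (* The list runs the other way; [flip1 f] starts in the same face and turns in the opposite
     direction. *)
  exists (flip1 f); rewrite h1 E; split=> //.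
  by rewrite /vert_step flip1K.
have sCf : face_cycle (faces X) (fvert f) s by rewrite fx.
have h1 : next s (fface f) = h 1 by rewrite fe hE next_mkseq -?hE.
have W := vert_walk_next sCf (etrans h1 fF).
have hk i : i <= n -> fface (iter i vert_step f) = h i.
  elim: i => // i IH lt; rewrite -W IH ?(ltnW lt) // hE next_mkseq -?hE //.
have sM : mkseq (fun i => fface (iter i vert_step f)) (size s) = s.
  rewrite {1}hE size_mkseq [RHS]hE; apply/eq_in_map=> i; rewrite mem_iota => /= lt.
  by rewrite hk // ltnW.
have nE : size s = n by rewrite hE size_mkseq.
exists f; rewrite sM; split=> //; last first.
  by rewrite /vert_word -{2}sM /mkseq -map_comp.
have vn := fvert_iter n f; rewrite nE.
have Fn : fface (iter n vert_step f) = fface f by rewrite hk // hn fe.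
(* After [n] steps the flag is back in its first face, so it is [f] or [flip1 f]; from [flip1 f] the
   next step would lead to the wrong neighbour. *)
have [//|E] := @flag_vert_face f (iter n vert_step f) (esym vn) (esym Fn).
have := W n; rewrite Fn (W 0) /= E [X in _ = fface X]/vert_step flip1K => /eqP.
by rewrite (negPf (vert_step_face f)).
Qed.

End Flags.

(** * Lifting a map along a local isomorphism *)

Lemma next_map_in (V W : finType) (g : V -> W) (s : seq V) x : uniq s ->
  {in s &, injective g} -> x \in s -> next (map g s) (g x) = g (next s x).
Proof.
move=> U inj xs; have s0 : s != [::] by case: (s) xs.
have [h [n [E hn n0]]] := mkseq_periodic U s0; subst s.
have E : map g (mkseq h n) = mkseq (g \o h) n by rewrite /mkseq -map_comp.
have U' : uniq (mkseq (g \o h) n) by rewrite -E map_inj_in_uniq.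
have /mapP[i] := xs; rewrite mem_iota add0n => /= lt ->.
by rewrite E (next_mkseq U' _ lt) /= ?hn // next_mkseq.
Qed.

(** * Automorphisms of a finite map *)

Section Automorphism.
Variable Y : polyhedral_map.

(** By finiteness, an injection that sends faces to faces permutes the vertices, the edges and the
    faces. *)
Lemma injective_automorphism (a : Y -> Y) : injective a ->
  (forall F, F \in faces Y -> face_image a F \in faces Y) -> automorphism a.
Proof.
move=> a_inj a_face.
have e_inj : injective (edge_image a) by apply: imset_inj.
have f_inj : injective (face_image a) by apply: imset_inj.
have fE : [set face_image a F | F in faces Y] = faces Y.
  apply/eqP; rewrite eqEcard card_imset // leqnn andbT.
  by apply/subsetP=> _ /imsetP[F FY ->]; apply: a_face.
have eE : [set edge_image a e | e in edges Y] = edges Y.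
  apply/eqP; rewrite eqEcard card_imset // leqnn andbT.
  apply/subsetP=> _ /imsetP[e /bigcupP[F FY eF] ->].
  by apply/bigcupP; exists (face_image a F); [apply: a_face | apply: imset_f].
split=> //; split=> //.
- by move=> y; have [b _ bK] := injF_bij a_inj; exists (b y).
- by move=> F _; rewrite card_imset.
- move=> u v /andP[uv uvE]; rewrite /vertex_adj /= (inj_eq a_inj) uv /=.
  rewrite -/(edges Y) -eE; apply/imsetP; exists [set u; v] => //.
  by rewrite edge_image2.
- move=> e f _ _ /andP[ef I0]; rewrite /edge_adj /= (inj_eq e_inj) ef /=.
  by rewrite -imsetI ?imset_eq0 // => x y _ _; apply: a_inj.
- move=> F G _ _ /andP[ef I0]; rewrite /face_adj /= (inj_eq f_inj) ef /=.
  by rewrite -imsetI ?imset_eq0 // => x y _ _; apply: e_inj.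
Qed.
End Automorphism.

Section Lift.
Variables (X : polyhedral_map) (V : finType) (K : {set face_of V}).
Variable eta : V -> X.
(** Apart from connectedness the conditions are local: [eta] embeds each face, matches the faces at
    [y] with those at [eta y], and is injective on the neighbours of [y]. The cell conditions of [X]
    then transfer to [K]. *)
Hypothesis K_polygon : forall F, F \in K -> is_polygon F.
Hypothesis K_inj : forall F, F \in K -> {in cover F &, injective eta}.
Hypothesis K_face : forall F, F \in K -> face_image eta F \in faces X.
Hypothesis K_star_inj : forall F G y, F \in K -> G \in K ->
  y \in cover F -> y \in cover G -> face_image eta F = face_image eta G -> F = G.
Hypothesis K_star_surj : forall y F', F' \in faces X -> eta y \in cover F' ->
  exists F, [/\ F \in K, y \in cover F & face_image eta F = F'].
Hypothesis K_nbr : forall y z z', [set y; z] \in cover K ->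
  [set y; z'] \in cover K -> eta z = eta z' -> z = z'.
Hypothesis V_gt0 : 0 < #|V|.
Hypothesis V_conn : forall u v, connect (vertex_adj K) u v.
Implicit Types (F G : face_of V) (e : edge_of V) (y z : V).

Lemma lift_card_edge F e : F \in K -> e \in F -> #|e| = 2.
Proof. by case/K_polygon=> s [s3 U ->]; apply: card_polygon_edge. Qed.

Lemma lift_edgeE F e y : F \in K -> e \in F -> y \in e ->
  exists z, e = [set y; z] /\ z \in cover F.
Proof.
move=> FK eF ye; have e2 := lift_card_edge FK eF.
exists (other e y); split; first exact: set2_other.
by apply/bigcupP; exists e => //; have [] := otherP e2 ye.
Qed.

Lemma lift_mem_cover F e y : e \in F -> y \in e -> y \in cover F.
Proof. by move=> eF ye; apply/bigcupP; exists e. Qed.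

Lemma lift_mem_edges F e : F \in K -> e \in F -> e \in cover K.
Proof. by move=> FK eF; apply/bigcupP; exists F. Qed.

Lemma lift_edge F (e' : edge_of X) y : F \in K -> y \in cover F ->
  e' \in face_image eta F -> eta y \in e' ->
  exists z, [/\ [set y; z] \in F, z \in cover F & e' = [set eta y; eta z]].
Proof.
move=> FK yF /imsetP[e eF ->] /imsetP[y' y'e yy'].
have E : y' = y by apply: (K_inj FK) => //; apply: lift_mem_cover eF y'e.
subst y'.
have [z [eE zF]] := lift_edgeE FK eF y'e; exists z.
by rewrite -edge_image2 -eE.
Qed.

(** The lift of [e'] inside [G] ends at a neighbour of [y] with the same image as [z], and [K_nbr]
    identifies the two. *)
Lemma lift_edge2 F G y z (e' : edge_of X) : F \in K -> [set y; z] \in F ->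
  G \in K -> y \in cover G -> e' \in face_image eta G -> e' = [set eta y; eta z] ->
  [set y; z] \in G.
Proof.
move=> FK yzF GK yG eG eE; rewrite eE in eG.
have [z' [yzG _ /set2_inj E]] := lift_edge GK yG eG (set21 _ _).
by rewrite (K_nbr (lift_mem_edges FK yzF) (lift_mem_edges GK yzG) E).
Qed.

Lemma lift_card_face F : F \in K -> #|face_image eta F| = #|F|.
Proof.
move=> FK; have [s [s3 U FE]] := K_polygon FK.
have inj : {in s &, injective eta}.
  by move: (K_inj FK); rewrite FE cover_polygon => inj x y xs ys; apply: inj; rewrite inE.
rewrite FE -polygon_map // !card_polygon ?size_map //.
by rewrite map_inj_in_uniq.
Qed.

(** Common vertices map to common vertices of the images, which are distinct faces by [K_star_inj];
    injectivity on a face pulls their intersection back. *)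
Lemma lift_faces_meet F G : F \in K -> G \in K -> F != G ->
  cover F :&: cover G != set0 -> meet_properly F G.
Proof.
move=> FK GK FG /set0Pn[y /setIP[yF yG]].
have FG' : face_image eta F != face_image eta G.
  by apply: contraNneq FG => /(K_star_inj FK GK yF yG) ->.
have sub z : z \in cover F :&: cover G ->
    eta z \in cover (face_image eta F) :&: cover (face_image eta G).
  by case/setIP=> zF zG; rewrite inE !cover_image !imset_f.
have yI := sub y (introT setIP (conj yF yG)).
have I0 : cover (face_image eta F) :&: cover (face_image eta G) != set0.
  by apply/set0Pn; exists (eta y).
have [/eqP/cards1P[x xI]|/setIP[IF IG]] :=
  faces_meet (K_face FK) (K_face GK) FG' I0.
  left; apply/eqP/cards1P; exists y; apply/setP=> z; rewrite [RHS]inE.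
  apply/idP/eqP=> [zI|->]; last by rewrite inE yF yG.
  have := sub z zI; have := yI; rewrite xI !inE => /eqP yx /eqP zx.
  by apply: (K_inj FK); [case/setIP: zI | | rewrite zx].
have [z [yzF zF eE]] := lift_edge FK yF IF yI.
have yzG := lift_edge2 FK yzF GK yG IG eE.
right; suff -> : cover F :&: cover G = [set y; z] by rewrite inE yzF.
apply/setP=> v; rewrite [RHS]inE !inE.
apply/andP/orP => [[vF vG]|[] /eqP->].
- have := sub v; rewrite inE vF => /(_ vG); rewrite eE !inE => /orP[] /eqP E.
    by left; apply/eqP; apply: (K_inj FK).
  by right; apply/eqP; apply: (K_inj FK).
- by split.
- by split=> //; apply: lift_mem_cover yzG (set22 _ _).
Qed.

Lemma lift_edge_two_faces e : e \in edge_set K -> #|[set F in K | e \in F]| = 2.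
Proof.
case/bigcupP=> F FK eF.
have /set0Pn[y ye] : e != set0 by rewrite -cards_eq0 (lift_card_edge FK eF).
have [z [eE zF]] := lift_edgeE FK eF ye.
have yF := lift_mem_cover eF ye.
rewrite -(@edge_two_faces X (edge_image eta e)); last first.
  by apply/bigcupP; exists (face_image eta F); [apply: K_face | apply: imset_f].
rewrite -(@card_in_imset _ _ (face_image eta)); last first.
  move=> G G'; rewrite !inE => /andP[GK eG] /andP[GK' eG'].
  by apply: (@K_star_inj G G' y) => //; apply: lift_mem_cover ye.
congr #|pred_of_set _|; apply/setP=> F'; rewrite inE.
apply/imsetP/andP=> [[G]|[FX eF']].
  by rewrite inE => /andP[GK eG] ->; split; [apply: K_face | apply: imset_f].
have e'E : edge_image eta e = [set eta y; eta z] by rewrite eE edge_image2.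
have yF' : eta y \in cover F'.
  by apply/bigcupP; exists (edge_image eta e); rewrite // e'E set21.
have [G [GK yG GE]] := K_star_surj FX yF'.
exists G => //; rewrite inE GK /= eE; rewrite eE in eF; rewrite -GE in eF'.
exact: lift_edge2 eF GK yG eF' e'E.
Qed.

(** Each face at [eta y] has exactly one lift at [y], so the cycle lifts face by face. Keeping the
    sizes is what lets vertex types lift. *)
Lemma lift_face_cycle y (s' : seq (face_of X)) :
  face_cycle (faces X) (eta y) s' ->
  exists2 s, face_cycle K y s &
    map (fun F : face_of V => #|F|) s = map (fun F : face_of X => #|F|) s'.
Proof.
case=> s0 U s'E s'C.
pose lift (F' : face_of X) := odflt set0 [pick F in faces_at K y | face_image eta F == F'].
have liftP (F' : face_of X) : F' \in s' ->
    [/\ lift F' \in K, y \in cover (lift F') & face_image eta (lift F') = F'].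
  rewrite s'E inE => /andP[FX yF]; rewrite /lift.
  have [F [FK yF2 FE]] := K_star_surj FX yF.
  case: pickP => [G|/(_ F)]; last by rewrite !inE FK yF2 FE eqxx.
  by rewrite !inE => /andP[/andP[GK yG] /eqP GE].
have lift_inj : {in s' &, injective lift}.
  move=> F G Fs Gs E; have [_ _ <-] := liftP F Fs; rewrite E.
  by have [] := liftP G Gs.
exists (map lift s').
  split; first by case: (s') s0.
  - by rewrite map_inj_in_uniq.
  - move=> F; rewrite inE; apply/mapP/andP => [[F' F's ->]|[FK yF]].
      by have [] := liftP F' F's.
    have F's : face_image eta F \in s'.
      rewrite s'E inE K_face //= cover_image; exact: imset_f.
    exists (face_image eta F) => //.
    by have [lK yl lE] := liftP _ F's; apply: (K_star_inj (y := y)).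
  - rewrite cycle_map.
    apply: (sub_in_cycle (P := [in s'])) s'C; last exact/allP.
    move=> F' G' F's G's /andP[FG /existsP[e' /andP[/setIP[eF eG] ye]]].
    have [FK yF FE] := liftP _ F's; have [GK yG GE] := liftP _ G's.
    rewrite /relpre /= /face_adj_at /=.
    apply/andP; split; first by rewrite (inj_in_eq lift_inj).
    rewrite -FE in eF; rewrite -GE in eG.
    have [z [yzF zF eE]] := lift_edge FK yF eF ye.
    have yzG := lift_edge2 FK yzF GK yG eG eE.
    by apply/existsP; exists [set y; z]; rewrite inE yzF yzG set21.
rewrite -map_comp; apply/eq_in_map=> F' F's /=.
by have [FK _ FE] := liftP _ F's; rewrite -{2}FE lift_card_face.
Qed.

Lemma lift_vertex_face_cycle y : exists s, face_cycle K y s.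
Proof.
have [s' s'C] := vertex_face_cycle (eta y).
by have [s sC _] := lift_face_cycle s'C; exists s.
Qed.

Definition lift_map : polyhedral_map :=
  PolyhedralMap K_polygon lift_faces_meet lift_edge_two_faces
    lift_vertex_face_cycle V_gt0 V_conn.

Lemma lift_vertex_type (y : lift_map) t :
  has_vertex_type (eta y) t -> has_vertex_type y t.
Proof. by case=> s' /lift_face_cycle[s sC sE] ->; exists s; rewrite ?sE. Qed.

(** Paths of the connected map [X] lift edge by edge from any starting vertex. *)
Lemma lift_surj x : exists y, eta y = x.
Proof.
have /card_gt0P[y0 _] := V_gt0.
have /connectP[p pP ->] := @map_connected X (eta y0) x.
elim/last_ind: p pP => [|p z IH] pP; first by exists y0.
move: pP; rewrite last_rcons rcons_path => /andP[/IH[y yE]].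
rewrite -yE => /andP[_ /bigcupP[F' FX eF]].
have yF : eta y \in cover F' by apply/bigcupP; exists [set eta y; z]; rewrite ?set21.
have [F [FK yF2 FE]] := K_star_surj FX yF; rewrite -FE in eF.
have [w [_ _ /set2_inj E]] := lift_edge FK yF2 eF (set21 _ _).
by exists w.
Qed.

Lemma lift_covering : covering (eta : lift_map -> X).
Proof.
have fE : [set face_image eta F | F in K] = faces X.
  apply/setP=> F'; apply/imsetP/idP=> [[F FK ->]|FX]; first exact: K_face.
  have [s [s3 _ E]] := faces_polygon FX.
  have [x xs] : exists x, x \in s.
    by case: (s) s3 => // x s1 _; exists x; rewrite mem_head.
  have [y yE] := lift_surj x.
  have [||F [FK _ FE]] := @K_star_surj y F'; rewrite ?FX //.
    by rewrite yE E cover_polygon inE.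
  by exists F.
split=> //.
- exact: lift_surj.
- apply/setP=> e'; apply/imsetP/bigcupP => [[e /bigcupP[F FK eF] ->]|[F']].
    by exists (face_image eta F); [apply: K_face | apply: imset_f].
  rewrite -fE => /imsetP[F FK ->] /imsetP[e eF ->]; exists e => //.
  exact: lift_mem_edges eF.
- exact: lift_card_face.
- move=> u v /andP[uv /bigcupP[F FK eF]]; apply/andP; split.
    apply: contra uv => /eqP E; apply/eqP; apply: (K_inj FK) => //.
      exact: lift_mem_cover eF (set21 _ _).
    exact: lift_mem_cover eF (set22 _ _).
  apply/bigcupP; exists (face_image eta F); first exact: K_face.
  by rewrite -edge_image2; apply: imset_f.
- move=> e f /bigcupP[F FK eF] /bigcupP[G GK fG] /andP[ef /set0Pn[y /setIP[ye yf]]].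
  apply/andP; split; last first.
    by apply/set0Pn; exists (eta y); rewrite inE !imset_f.
  have [a [eE _]] := lift_edgeE FK eF ye; have [b [fE' _]] := lift_edgeE GK fG yf.
  apply: contraNneq ef; rewrite eE fE' !edge_image2 => /set2_inj E.
  rewrite eE in eF; rewrite fE' in fG.
  by rewrite (K_nbr (lift_mem_edges FK eF) (lift_mem_edges GK fG) E).
- move=> F G FK GK /andP[FG /set0Pn[e /setIP[eF eG]]].
  have /set0Pn[y ye] : e != set0 by rewrite -cards_eq0 (lift_card_edge FK eF).
  apply/andP; split; last first.
    by apply/set0Pn; exists (edge_image eta e); rewrite inE !imset_f.
  apply: contraNneq FG => /(@K_star_inj F G y FK GK) -> //;
  exact: lift_mem_cover ye.
Qed.

(** The direction of each face is pulled back through the inverse of [eta] on that face; [y0] is a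
    dummy value outside the image of the face. *)
Lemma lift_orientable : orientable X -> orientable lift_map.
Proof.
case=> o [oP oO]; have /card_gt0P[y0 _] := V_gt0.
pose inv F x := odflt y0 [pick y in cover F | eta y == x].
have invK F : F \in K -> {in cover F, cancel eta (inv F)}.
  move=> FK y yF; rewrite /inv; case: pickP => [z|/(_ y)]; last by rewrite yF eqxx.
  by case/andP=> zF /eqP /(K_inj FK zF yF).
pose oY F := map (inv F) (o (face_image eta F)).
have oE F : F \in K -> [/\ map eta (oY F) = o (face_image eta F), uniq (oY F),
   {subset oY F <= cover F} & F = polygon (oY F)].
  move=> FK; have [_ oU FE] := oP _ (K_face FK).
  set s := o _ in oU FE *.
  have sP x : x \in s -> exists2 y, y \in cover F & x = eta y.
    move=> xs; have: x \in cover (face_image eta F) by rewrite FE cover_polygon inE.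
    by rewrite cover_image => /imsetP[y yF ->]; exists y.
  have inv_inj : {in s &, injective (inv F)}.
    move=> _ _ /sP[y yF ->] /sP[z zF ->]; rewrite !invK //.
    by move->.
  have U : uniq (map (inv F) s) by rewrite map_inj_in_uniq.
  split=> //.
  - rewrite -map_comp -[RHS]map_id; apply/eq_in_map=> _ /sP[y yF ->] /=.
    by rewrite invK.
  - by move=> _ /mapP[_ /sP[y yF ->] ->]; rewrite invK.
  - rewrite polygon_map // -FE /face_image -imset_comp.
    rewrite -[LHS]imset_id; apply: eq_in_imset => e eF /=.
    rewrite /edge_image -imset_comp -[LHS]imset_id; apply: eq_in_imset => y ye /=.
    by rewrite invK //; apply: lift_mem_cover eF ye.
exists oY; split=> [F FK|F G u v FK GK FG uF uG nF nG].
  have [_ U _ E] := oE F FK; split=> //.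
  by rewrite size_map; have [] := oP _ (K_face FK).
have [mF UF sF _] := oE F FK; have [mG UG sG _] := oE G GK.
have FG' : face_image eta F != face_image eta G.
  by apply: contraNneq FG => /(K_star_inj FK GK (sF _ uF) (sG _ uG)) ->.
have nx H : H \in K -> u \in oY H -> next (oY H) u = v ->
    next (o (face_image eta H)) (eta u) = eta v.
  move=> HK uH <-; have [mH UH sH _] := oE H HK; rewrite -mH next_map_in //.
  by move=> a b aH bH; apply: (K_inj HK); apply: sH.
apply: (oO _ _ (eta u) (eta v) (K_face FK) (K_face GK) FG'); last exact: nx.
- by rewrite -mF map_f.
- by rewrite -mG map_f.
- exact: nx.
Qed.
End Lift.

(** * Words of flags *)

Section Typed.
Variables (X : polyhedral_map) (t : seq nat).
Hypothesis X_type : forall x : X, has_vertex_type x t.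
Local Notation d := (size t).
Local Notation vs := (@vert_step X).
Implicit Types f g h : flag X.

(** The dihedral relation at a vertex: conjugation by [flip1] inverts [vert_step]. *)
Lemma vert_step_flip1 f : vs (flip1 (vs f)) = flip1 f.
Proof. by rewrite /vert_step flip1K flip2K. Qed.

Lemma iter_vert_step_flip1 i f : iter i vs (flip1 (iter i vs f)) = flip1 f.
Proof. by elim: i f => // i IH f; rewrite iterSr vert_step_flip1 IH. Qed.

Lemma vert_step_inj : injective vs.
Proof. exact: (inj_comp (inv_inj (@flip2K X)) (inv_inj (@flip1K X))). Qed.

(** One flag at [x] reads the type exactly as [t], and its turns and their reflections are all the
    flags at [x]; claims about other flags are reduced to this one. *)
Lemma base_flag x : exists f, [/\ fvert f = x, vert_word d f = t,
  forall i j, fface (iter i vs f) = fface (iter j vs f) -> i = j %[mod d],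
  iter d vs f = f & forall g, fvert g = x ->
    exists2 i, i < d & g = iter i vs f \/ g = flip1 (iter i vs f)].
Proof.
have [f [fx fd fw /mkseq_uniqP inj fs]] := vertex_type_flag (X_type x).
have d0 : 0 < d.
  rewrite lt0n; apply: contraTneq (mem_faces_at f) => d0.
  by rewrite fx -fs d0.
have fixM k : iter (k * d) vs f = f.
  by elim: k => // k IH; rewrite mulSn addnC iterD fd.
exists f; split=> // [i j|g gx].
  rewrite {1}(divn_eq i d) {1}(divn_eq j d) ![_ * d + _]addnC !iterD !fixM.
  by move=> /(inj (i %% d) (j %% d)) -> //; rewrite inE ltn_pmod.
have := mem_faces_at g; rewrite gx -fs => /mapP[i]; rewrite mem_iota => /= lt E.
exists i => //; apply: flag_vert_face; first by rewrite fvert_iter gx.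
by rewrite E.
Qed.

Lemma degree_gt0 : 0 < d.
Proof.
have /card_gt0P[x _] := map_nonempty X.
by have [f [fx _ _ _ /(_ f fx)[i /(leq_ltn_trans (leq0n i))]]] := base_flag x.
Qed.

Lemma vert_step_degree f : iter d vs f = f.
Proof.
have [h [_ _ _ hd /(_ f erefl)[i _ [->|->]]]] := base_flag (fvert f).
  by rewrite -iterD addnC iterD hd.
have E : iter d vs (iter i vs h) = iter i vs h by rewrite -iterD addnC iterD hd.
by rewrite -{1}E iter_vert_step_flip1.
Qed.

Lemma vert_step_mul k f : iter (k * d) vs f = f.
Proof. by elim: k => // k IH; rewrite mulSn addnC iterD vert_step_degree. Qed.

Lemma vert_step_back i f : i <= d -> iter i vs (iter (d - i) vs f) = f.
Proof. by move=> id; rewrite -iterD subnKC // vert_step_degree. Qed.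

Lemma vert_step_face_free f i : fface (iter i vs f) = fface f -> d %| i.
Proof.
have [h [_ _ hF hd /(_ f erefl)[j jd fE]]] := base_flag (fvert f).
have dvd k : k + j = j %[mod d] -> d %| k.
  by move/eqP; rewrite -[X in _ == X %[mod _]]add0n eqn_modDr mod0n.
case: fE => ->; first by rewrite -iterD => /hF/dvd.
set g := iter j vs h; have d0 := degree_gt0.
(* [i * d.-1] stands for [-i] modulo [d]: turning back first lets the dihedral relation absorb the
   [i] turns. *)
have E : iter i vs (iter (i * d.-1) vs g) = g.
  by rewrite -iterD -mulnS prednK // vert_step_mul.
rewrite -{1}E iter_vert_step_flip1 => E2.
have /dvd : i * d.-1 + j = j %[mod d] by apply: hF; rewrite iterD.
have : d %| i * d.-1 + i by rewrite addnC -mulnS prednK // dvdn_mull.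
by move=> di dj; rewrite dvdn_addr in di.
Qed.

Lemma vert_step_free f i : iter i vs f = f -> d %| i.
Proof. by move=> E; apply: (@vert_step_face_free f); rewrite E. Qed.

Lemma flip1_vert_step_free f i : iter i vs f <> flip1 f.
Proof.
move=> E; have /dvdnP[k iE] : d %| i by apply: (@vert_step_face_free f); rewrite E.
by have := flip1_edge f; rewrite -E iE vert_step_mul eqxx.
Qed.

Local Notation w := (@vert_word X d).

Lemma word_step f : w (vs f) = rot 1 (w f).
Proof.
rewrite /vert_word; case: (size t) (vert_step_degree f) => // n E.
rewrite mkseqS -iterSr E /mkseq /= rot1_cons; congr rcons.
rewrite -[1]addn0 iotaDl -map_comp; apply/eq_map=> i /=.
by rewrite -iterSr.
Qed.

Lemma word_flip2 f : w (flip2 f) = rev (w f).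
Proof.
apply: (@eq_from_nth _ 0) => [|i]; rewrite ?size_rev !size_mkseq // => id.
rewrite nth_rev ?size_mkseq // !nth_mkseq //; last by rewrite ltn_subrL degree_gt0.
congr #|pred_of_set _|.
have <- : vs (flip1 f) = flip2 f by rewrite /vert_step flip1K.
rewrite -iterSr -{1}(vert_step_back f id).
by rewrite iter_vert_step_flip1.
Qed.

Lemma word_flip1 f : w (flip1 f) = rev (rot 1 (w f)).
Proof. by rewrite -word_step -word_flip2 /vert_step flip2K. Qed.

Lemma word_iter i f : i <= d -> w (iter i vs f) = rot i (w f).
Proof.
elim: i => [|i IH] id; first by rewrite rot0.
by rewrite /= word_step IH ?(ltnW id) // -rotS // size_mkseq.
Qed.

(** The full turn [rot (size u)] is listed as well, so that [flip1], which rotates once more, stays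
    in the list without a case distinction. *)
Definition word_class (u : seq nat) : seq (seq nat) :=
  [seq rot i u | i <- iota 0 (size u).+1] ++
  [seq rev (rot i u) | i <- iota 0 (size u).+1].

Lemma mem_word_class f : w f \in word_class t.
Proof.
have [h [_ hw _ _ /(_ f erefl)[i id [->|->]]]] := base_flag (fvert f).
  rewrite word_iter ?(ltnW id) // hw mem_cat (map_f (fun i => rot i t)) //.
  by rewrite mem_iota /= add0n ltnS (ltnW id).
rewrite word_flip1 word_iter ?(ltnW id) // hw mem_cat -rotS //.
by rewrite (map_f (fun i => rev (rot i t))) ?orbT // mem_iota add0n ltnS.
Qed.
End Typed.

(** * The cover defined by a labelling of the flags *)

Section GenInd.
Local Open Scope group_scope.
Variable gT : finGroupType.

Lemma gen_indr (A : {set gT}) (P : gT -> Prop) : P 1 ->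
  (forall g s, g \in <<A>> -> s \in A -> P g -> P (g * s)) ->
  forall g, g \in <<A>> -> P g.
Proof.
move=> P1 PM g /gen_prodgP[n [c cA ->]].
suff [] : (\prod_(i < n) c i \in <<A>>) /\ P (\prod_(i < n) c i) by [].
elim: n c cA => [|n IH] c cA; first by rewrite big_ord0 group1.
rewrite big_ord_recr /=; have [gG Pg] := IH (fun i => c (widen_ord (leqnSn n) i)) (fun i => cA _).
split; first by rewrite groupM // mem_gen.
exact: PM.
Qed.

(** Two involutions generate a dihedral group, made of rotations and reflections. *)
Lemma gen_involutions (a b : gT) : a * a = 1 -> b * b = 1 ->
  forall k, k \in <<[set a; b]>> ->
  exists i, k = (a * b) ^+ i \/ k = (a * b) ^+ i * a.
Proof.
move=> aa bb; apply: gen_indr => [|g s _]; first by exists 0; left; rewrite expg0.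
rewrite !inE => /orP[] /eqP-> [i [->|->]].
- by exists i; right.
- by exists i; left; rewrite -mulgA aa mulg1.
(* [#[a * b].-1] plays the exponent -1. *)
- exists (i + #[a * b].-1); right.
  have E : (a * b) ^+ i = (a * b) ^+ (i + #[a * b].-1) * (a * b).
    by rewrite -expgSr -addnS prednK ?order_gt0 // expgD expg_order mulg1.
  by rewrite {1}E -!mulgA bb mulg1.
- by exists i.+1; left; rewrite expgSr mulgA.
Qed.
End GenInd.

Lemma map_uniq_inj (T1 T2 : eqType) (h : T1 -> T2) (s : seq T1) :
  uniq (map h s) -> {in s &, injective h}.
Proof.
elim: s => //= z s IH /andP[zs U] x y; rewrite !inE.
case/predU1P=> [->|xs] /predU1P[->|ys] // E; last exact: IH.
  by rewrite E map_f in zs.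
by rewrite -E map_f in zs.
Qed.

Section Cover.
Local Open Scope group_scope.
Variables (X : polyhedral_map) (t : seq nat).
Hypothesis X_type : forall x : X, has_vertex_type x t.
Variables (T : eqType) (tau : flag X -> T) (l : T).
Hypothesis tau0 : forall f g, tau f = tau g -> tau (flip0 f) = tau (flip0 g).
Hypothesis tau1 : forall f g, tau f = tau g -> tau (flip1 f) = tau (flip1 g).
Hypothesis tau2 : forall f g, tau f = tau g -> tau (flip2 f) = tau (flip2 g).
Hypothesis tau_face : forall f g, tau f = tau g -> #|fface f| = #|fface g|.
Hypothesis tau_vert : forall x, exists2 f, fvert f = x & tau f = l.
Implicit Types (f : flag X) (g h k u : {perm flag X}).

Definition p0 : {perm flag X} := perm (inv_inj (@flip0K X)).
Definition p1 : {perm flag X} := perm (inv_inj (@flip1K X)).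
Definition p2 : {perm flag X} := perm (inv_inj (@flip2K X)).

Lemma p0E f : p0 f = flip0 f. Proof. exact: permE. Qed.
Lemma p1E f : p1 f = flip1 f. Proof. exact: permE. Qed.
Lemma p2E f : p2 f = flip2 f. Proof. exact: permE. Qed.

Lemma p0K : p0 * p0 = 1.
Proof. by apply/permP=> f; rewrite permM !p0E flip0K perm1. Qed.
Lemma p1K : p1 * p1 = 1.
Proof. by apply/permP=> f; rewrite permM !p1E flip1K perm1. Qed.
Lemma p2K : p2 * p2 = 1.
Proof. by apply/permP=> f; rewrite permM !p2E flip2K perm1. Qed.
Lemma p02 : p0 * p2 = p2 * p0.
Proof. by apply/permP=> f; rewrite !permM !p0E !p2E flip02. Qed.

Definition monodromy := <<[set p0; p1; p2]>>.
Definition vert_group := <<[set p1; p2]>>.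
Definition face_group := <<[set p0; p1]>>.
Local Notation G := monodromy.
Local Notation K12 := vert_group.
Local Notation K01 := face_group.

Lemma p0G : p0 \in G. Proof. by rewrite mem_gen // !inE eqxx. Qed.
Lemma p1G : p1 \in G. Proof. by rewrite mem_gen // !inE eqxx ?orbT. Qed.
Lemma p2G : p2 \in G. Proof. by rewrite mem_gen // !inE eqxx ?orbT. Qed.
Lemma p1K12 : p1 \in K12. Proof. by rewrite mem_gen // !inE eqxx. Qed.
Lemma p2K12 : p2 \in K12. Proof. by rewrite mem_gen // !inE eqxx ?orbT. Qed.
Lemma p0K01 : p0 \in K01. Proof. by rewrite mem_gen // !inE eqxx. Qed.
Lemma p1K01 : p1 \in K01. Proof. by rewrite mem_gen // !inE eqxx ?orbT. Qed.

Lemma K12_G k : k \in K12 -> k \in G.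
Proof.
apply: subsetP; apply: genS; apply/subsetP=> g; rewrite !inE => /orP[] ->;
by rewrite ?orbT.
Qed.

Lemma K01_G k : k \in K01 -> k \in G.
Proof.
apply: subsetP; apply: genS; apply/subsetP=> g; rewrite !inE => /orP[] ->;
by rewrite ?orbT.
Qed.

Lemma vert_stepE i f : ((p1 * p2) ^+ i) f = iter i (@vert_step X) f.
Proof. by rewrite permX; apply: eq_iter => {}f; rewrite permM p1E p2E. Qed.

Lemma face_stepE i f : ((p0 * p1) ^+ i) f = iter i (@face_step X) f.
Proof. by rewrite permX; apply: eq_iter => {}f; rewrite permM p0E p1E. Qed.

Lemma tau_G g f f' : g \in G -> tau f = tau f' -> tau (g f) = tau (g f').
Proof.
move=> gG E; elim/gen_indr: g / gG => [|g s _]; first by rewrite !perm1.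
rewrite !inE !permM => /orP[/orP[]|] /eqP-> IH; rewrite ?p0E ?p1E ?p2E.
- exact: tau0.
- exact: tau1.
- exact: tau2.
Qed.

Lemma fvert_K12 k f : k \in K12 -> fvert (k f) = fvert f.
Proof.
move=> kK; elim/gen_indr: k / kK => [|g s _]; first by rewrite perm1.
by rewrite !inE permM => /orP[] /eqP-> <-; rewrite ?p1E ?p2E.
Qed.

(** All vertices have the same degree, so a rotation that fixes one flag fixes them all; a
    reflection fixes none. *)
Lemma K12_free k f : k \in K12 -> k f = f -> k = 1.
Proof.
case/(gen_involutions p1K p2K)=> i [->|->].
  rewrite vert_stepE => /(vert_step_free X_type)/dvdnP[j ->].
  by apply/permP=> f'; rewrite vert_stepE (vert_step_mul X_type) perm1.
rewrite permM vert_stepE p1E => E.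
by case: (@flip1_vert_step_free _ _ X_type f i); rewrite -{2}E flip1K.
Qed.

Lemma K12_trans f f' : fvert f = fvert f' -> exists2 k, k \in K12 & k f = f'.
Proof.
move=> E; have [h [_ _ _ _ hT]] := base_flag X_type (fvert f).
have toh f1 : fvert f1 = fvert f -> exists2 k, k \in K12 & k h = f1.
  have r12 i : (p1 * p2) ^+ i \in K12 by rewrite groupX // groupM ?p1K12 ?p2K12.
  case/hT=> i _ [->|->]; first by exists ((p1 * p2) ^+ i); rewrite // vert_stepE.
  exists ((p1 * p2) ^+ i * p1); first by rewrite groupM // p1K12.
  by rewrite permM vert_stepE p1E.
have [k kK kE] := toh f erefl; have [k' kK' kE'] := toh f' (esym E).
by exists (k^-1 * k'); rewrite ?groupM ?groupV // permM -kE permK.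
Qed.

(** Face sizes vary, so fixing a flag carries over only to flags in faces of the same size, which
    equal labels guarantee. *)
Lemma K01_free k f f' : k \in K01 -> k f = f -> tau f = tau f' -> k f' = f'.
Proof.
move=> + + E; case/(gen_involutions p0K p1K)=> i [->|->].
  rewrite !face_stepE => /face_step_free; rewrite (tau_face E) => /dvdnP[j ->].
  have [_ _ fixn _] := face_walk f'.
  by elim: j => // j IH; rewrite mulSn iterD IH.
rewrite permM face_stepE p0E => E2.
by case: (@flip0_face_step_free _ f i); rewrite -{2}E2 flip0K.
Qed.

(* [eq_base] and [vtx] below are opaque, because unification would otherwise
   try to evaluate them. *)
Lemma eq_base_sig : {r : rel {perm flag X} &
  forall g g', reflect (forall f, tau f = l -> g f = g' f) (r g g')}.
Proof.
exists (fun g g' => [forall f, (tau f == l) ==> (g f == g' f)]) => g g'.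
apply: (iffP forallP) => H f; first by move/eqP=> E; have := H f; rewrite E => /eqP.
by apply/implyP=> /eqP /H ->.
Qed.

Definition eq_base := projT1 eq_base_sig.

Lemma eq_baseP g g' : reflect (forall f, tau f = l -> g f = g' f) (eq_base g g').
Proof. exact: (projT2 eq_base_sig). Qed.

Lemma eq_base_mulr g g' h : eq_base g g' -> eq_base (g * h) (g' * h).
Proof. by move=> /eq_baseP E; apply/eq_baseP=> f fl; rewrite !permM E. Qed.

(** The coset of [g] modulo [vert_group], up to agreement on the flags with label [l]. Since
    [(g * k) f = k (g f)], right factors move the flag [g f] and left factors precompose. *)
Definition vclass g :=
  [set g' in G | [exists k, (k \in K12) && eq_base (g * k) g']].

Definition cover_vertex := {S : {set {perm flag X}} | S \in vclass @: G}.

Lemma vtx_sig :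
  {v : {perm flag X} -> cover_vertex | forall g, g \in G -> val (v g) = vclass g}.
Proof.
have v1 : vclass 1 \in vclass @: G by rewrite imset_f ?group1.
(* The class of [1] is a dummy, used only when [vclass g] is not the class of an element of [G]. *)
exists (fun g => insubd (exist (fun S => S \in vclass @: G) _ v1) (vclass g)).
move=> g gG; apply: insubdK; exact: imset_f.
Qed.

Definition vtx := sval vtx_sig.

Lemma vtxK g : g \in G -> val (vtx g) = vclass g.
Proof. exact: (svalP vtx_sig). Qed.

Lemma mem_vclass g : g \in G -> g \in vclass g.
Proof.
move=> gG; rewrite inE gG; apply/existsP; exists 1; rewrite group1 mulg1.
by apply/eq_baseP.
Qed.

Lemma vtx_eq g g' : g \in G -> g' \in G ->
  (exists2 k, k \in K12 & eq_base (g * k) g') <-> vtx g = vtx g'.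
Proof.
move=> gG gG'; split=> [[k kK E]|/(congr1 val)].
  apply: val_inj; rewrite (vtxK gG) (vtxK gG'); apply/setP=> h.
  rewrite /vclass [LHS]in_set [RHS]in_set.
  apply/andP/andP=> -[hG /existsP[k' /andP[kK' E']]].
    split; first exact: hG.
    apply/existsP; exists (k^-1 * k'); apply/andP; split.
      by rewrite groupM ?groupV.
    apply/eq_baseP=> f fl.
    have /eq_baseP/(_ f fl) <- := E'; have /eq_baseP/(_ f fl) := E.
    by rewrite !permM => <-; rewrite permK.
  split; first exact: hG.
  apply/existsP; exists (k * k'); apply/andP; split; first by rewrite groupM.
  apply/eq_baseP=> f fl.
  have /eq_baseP/(_ f fl) <- := E'; have /eq_baseP/(_ f fl) := E.
  by rewrite !permM => <-.
rewrite (vtxK gG) (vtxK gG') => E; have := mem_vclass gG'; rewrite -E inE gG' /=.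
by case/existsP=> k /andP[kK E2]; exists k.
Qed.

Lemma vtxP v : exists2 g, g \in G & v = vtx g.
Proof.
have /imsetP[g gG E] := valP v; exists g => //.
by apply: val_inj; rewrite vtxK.
Qed.

Lemma vtx_K12 g k : g \in G -> k \in K12 -> vtx (g * k) = vtx g.
Proof.
move=> gG kK; symmetry; apply/vtx_eq => //; first by rewrite groupM // K12_G.
by exists k => //; apply/eq_baseP.
Qed.

Lemma vtx_eq_base g g' : g \in G -> g' \in G -> eq_base g g' -> vtx g = vtx g'.
Proof. by move=> gG gG' E; apply/vtx_eq => //; exists 1; rewrite ?group1 ?mulg1. Qed.

Variable f0 : flag X.
Hypothesis f0_l : tau f0 = l.

(** Evaluation at [f0]; [cover_projE] shows independence of the representative. *)
Definition cover_proj (v : cover_vertex) : X := fvert (repr (val v) f0).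
Local Notation eta := cover_proj.

Lemma cover_projE g : g \in G -> eta (vtx g) = fvert (g f0).
Proof.
move=> gG; rewrite /cover_proj vtxK //.
have := mem_repr _ (mem_vclass gG); rewrite inE => /andP[_ /existsP[k]].
case/andP=> kK /eq_baseP/(_ f0 f0_l) <-; rewrite permM; exact: fvert_K12.
Qed.

Definition cover_edge g : edge_of cover_vertex := [set vtx g; vtx (g * p0)].
Definition cover_face g : face_of cover_vertex :=
  [set cover_edge (g * k) | k in K01].
Definition cover_faces := [set cover_face g | g in G].

Lemma cover_edge_p0 g : cover_edge (g * p0) = cover_edge g.
Proof. by rewrite /cover_edge -mulgA p0K mulg1 setUC. Qed.

Lemma cover_edge_eq_base g g' : g \in G -> g' \in G -> eq_base g g' ->
  cover_edge g = cover_edge g'.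
Proof.
move=> gG gG' E; rewrite /cover_edge (vtx_eq_base gG gG' E).
suff -> : vtx (g * p0) = vtx (g' * p0) by [].
by apply: vtx_eq_base; [apply: groupM gG p0G | apply: groupM gG' p0G | apply: eq_base_mulr].
Qed.

Lemma cover_face_K01 g k : k \in K01 -> cover_face (g * k) = cover_face g.
Proof.
move=> kK; apply/setP=> e; apply/imsetP/imsetP=> -[k' kK' ->].
  by exists (k * k'); rewrite ?groupM // mulgA.
exists (k^-1 * k'); first by rewrite ?groupM ?groupV.
by rewrite -mulgA mulKVg.
Qed.

Lemma cover_face_eq_base g g' : g \in G -> g' \in G -> eq_base g g' ->
  cover_face g = cover_face g'.
Proof.
move=> gG gG' E; apply: eq_in_imset => k /K01_G kG.
by apply: cover_edge_eq_base; rewrite ?groupM // eq_base_mulr.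
Qed.

(** The images under [g] of all flags with label [l] share one label, so a turn that fixes one of
    them fixes all. *)
Lemma K01_eq_base g k : g \in G -> k \in K01 -> k (g f0) = g f0 ->
  eq_base (g * k) g.
Proof.
move=> gG kK E; apply/eq_baseP=> f fl; rewrite permM.
by apply: K01_free E _ => //; apply: tau_G => //; rewrite fl.
Qed.

(** By [K01_eq_base] the walk around a face of the cover closes up after as many steps as its image
    in [X]; its vertices are distinct because their images are. *)
Lemma cover_face_walk g (n := #|fface (g f0)|)
    (s := mkseq (fun i => vtx (g * (p0 * p1) ^+ i)) n) : g \in G ->
  [/\ 3 <= n, uniq (map eta s), fface (g f0) = polygon (map eta s) &
      cover_face g = polygon s].
Proof.
move=> gG; have [n3 U fixn FE] := face_walk (g f0).
have rK i : (p0 * p1) ^+ i \in K01 by rewrite groupX // groupM ?p0K01 ?p1K01.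
have rG i : g * (p0 * p1) ^+ i \in G by rewrite groupM // K01_G.
have sE : map eta s = mkseq (fun i => fvert (iter i (@face_step X) (g f0))) n.
  rewrite -map_comp; apply/eq_map => i /=.
  by rewrite cover_projE // permM face_stepE.
rewrite sE; split=> //.
have Us : uniq s by apply: (@map_uniq _ _ eta); rewrite sE.
have En i j : i = j %[mod n] -> eq_base (g * (p0 * p1) ^+ i) (g * (p0 * p1) ^+ j).
  have n0 : 0 < n by apply: ltn_trans n3.
  have E0 m : eq_base (g * (p0 * p1) ^+ (m * n)) g.
    apply: K01_eq_base => //; rewrite face_stepE.
    by elim: m => // m IH; rewrite mulSn iterD IH.
  have E1 m : eq_base (g * (p0 * p1) ^+ m) (g * (p0 * p1) ^+ (m %% n)).
    rewrite {1}(divn_eq m n) expgD mulgA; exact: eq_base_mulr.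
  move=> E; have /eq_baseP Ei := E1 i; have /eq_baseP Ej := E1 j.
  by apply/eq_baseP=> f fl; rewrite Ei // Ej // E.
rewrite polygon_mkseq //; last first.
  by apply: vtx_eq_base => //; apply: En; rewrite modnn mod0n.
have eE i : cover_edge (g * (p0 * p1) ^+ i) =
    [set vtx (g * (p0 * p1) ^+ i); vtx (g * (p0 * p1) ^+ i.+1)].
  rewrite /cover_edge; congr [set _; _]; rewrite expgSr !mulgA.
  by rewrite [RHS]vtx_K12 ?p1K12 // groupM ?p0G.
apply/setP=> e; apply/imsetP/imsetP=> [[k kK ->]|[i _ ->]]; last first.
  by exists ((p0 * p1) ^+ i).
have n0 : 0 < n by apply: ltn_trans n3.
have [i [->|->]] := gen_involutions p0K p1K kK; rewrite ?mulgA ?cover_edge_p0.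
all: exists (Ordinal (ltn_pmod i n0)) => //=; rewrite -eE.
all: by apply: cover_edge_eq_base => //; apply: En; rewrite modn_mod.
Qed.

Lemma mem_cover_face g : g \in G -> vtx g \in cover (cover_face g).
Proof.
move=> gG; apply/bigcupP; exists (cover_edge g); last exact: set21.
by apply/imsetP; exists 1; rewrite ?group1 ?mulg1.
Qed.

Lemma cover_faces_at F v : F \in cover_faces -> v \in cover F ->
  exists g, [/\ g \in G, v = vtx g & F = cover_face g].
Proof.
case/imsetP=> g gG -> /bigcupP[_ /imsetP[k kK ->]]; have kG := K01_G kK.
rewrite !inE => /orP[] /eqP->.
  by exists (g * k); rewrite groupM // cover_face_K01.
by exists (g * k * p0); rewrite !groupM ?p0G // !cover_face_K01 ?p0K01.
Qed.

Lemma cover_face_inj g : g \in G ->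
  {in cover (cover_face g) &, injective eta}.
Proof.
move=> gG; have [_ U _ ->] := cover_face_walk gG; rewrite cover_polygon.
by move=> x y; rewrite !inE => xs ys; apply: (map_uniq_inj U).
Qed.

Lemma cover_face_image g : g \in G ->
  face_image eta (cover_face g) = fface (g f0).
Proof.
move=> gG; have [_ U FE ->] := cover_face_walk gG; rewrite [RHS]FE.
by rewrite polygon_map // ?(map_uniq U) //; apply: map_uniq_inj.
Qed.

Lemma cover_is_polygon F : F \in cover_faces -> is_polygon F.
Proof.
case/imsetP=> g gG ->; have [n3 U _ E] := cover_face_walk gG.
by eexists; split; last exact: E; rewrite ?size_mkseq // (map_uniq U).
Qed.

Lemma cover_inj F : F \in cover_faces -> {in cover F &, injective eta}.
Proof. by case/imsetP=> g gG ->; apply: cover_face_inj. Qed.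

Lemma cover_image_face F : F \in cover_faces -> face_image eta F \in faces X.
Proof.
by case/imsetP=> g gG ->; rewrite cover_face_image //; case: (flagP (g f0)).
Qed.

Lemma eq_base_K12 g g' k : k \in K12 -> eq_base (g * k) g' -> g' f0 = k (g f0).
Proof. by move=> _ /eq_baseP/(_ f0 f0_l) <-; rewrite permM. Qed.

(** Representatives at the same vertex differ by some [k] in [vert_group]. If their flags lie in the
    same face, freeness forces [k] to be [1] or [p1], and [p1] also belongs to [face_group]. *)
Lemma cover_star_inj F F' v : F \in cover_faces -> F' \in cover_faces ->
  v \in cover F -> v \in cover F' -> face_image eta F = face_image eta F' -> F = F'.
Proof.
move=> FC FC' vF vF'.
have [g [gG vE ->]] := cover_faces_at FC vF.
have [g' [gG' vE' ->]] := cover_faces_at FC' vF'.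
rewrite !cover_face_image // => E.
have [k kK kE] := (vtx_eq gG gG').2 (etrans (esym vE) vE').
have kf := eq_base_K12 kK kE.
have Ev : fvert (g f0) = fvert (g' f0) by rewrite kf (fvert_K12 _ kK).
have [/(etrans (esym kf)) E2|/(etrans (esym kf)) E2] := flag_vert_face Ev E.
  rewrite (K12_free kK E2) mulg1 in kE; exact: cover_face_eq_base.
have kp1 : k = p1.
  have : (k * p1) (g f0) = g f0 by rewrite permM E2 p1E flip1K.
  move/(K12_free (groupM kK p1K12)) => H.
  by rewrite -[k]mulg1 -p1K mulgA H mul1g.
rewrite kp1 in kE; rewrite -(@cover_face_K01 g p1) ?p1K01 //.
by apply: cover_face_eq_base => //; apply: groupM gG p1G.
Qed.

Lemma cover_star_surj v F' : F' \in faces X -> eta v \in cover F' ->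
  exists F, [/\ F \in cover_faces, v \in cover F & face_image eta F = F'].
Proof.
have [g gG ->] := vtxP v; rewrite cover_projE // => FX /bigcupP[e eF ve].
have [f [fv _ fF]] := mk_flag ve eF FX.
have [k kK kE] := K12_trans (esym fv); have gkG := groupM gG (K12_G kK).
exists (cover_face (g * k)); split.
- exact: imset_f.
- by rewrite -(vtx_K12 gG kK) mem_cover_face.
- by rewrite cover_face_image // permM kE.
Qed.

Lemma vtx_p0_neq g : g \in G -> vtx g != vtx (g * p0).
Proof.
move=> gG; apply/eqP=> /(congr1 eta); rewrite !cover_projE ?(groupM gG p0G) //.
by move/esym/eqP; rewrite permM p0E (negPf (flip0_vert _)).
Qed.

Lemma cover_edge_at v v' : [set v; v'] \in cover cover_faces ->
  exists g, [/\ g \in G, v = vtx g & v' = vtx (g * p0)].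
Proof.
case/bigcupP=> _ /imsetP[g1 g1G ->] /imsetP[k kK E].
have gG := groupM g1G (K01_G kK); move: E gG; set g := g1 * k.
move=> E gG; have gpG := groupM gG p0G.
have : vtx g \in [set v; v'] by rewrite E set21.
have : vtx (g * p0) \in [set v; v'] by rewrite E set22.
have := vtx_p0_neq gG.
rewrite !inE => + /orP[] /eqP E1 /orP[] /eqP E2; rewrite E1 E2 ?eqxx // => _.
  by exists (g * p0); split=> //; rewrite -mulgA p0K mulg1.
by exists g.
Qed.

Lemma cover_nbr (v u u' : cover_vertex) : [set v; u] \in cover cover_faces ->
  [set v; u'] \in cover cover_faces -> eta u = eta u' -> u = u'.
Proof.
case/cover_edge_at=> g [gG -> ->] /cover_edge_at[g' [gG' vE ->]].
rewrite !cover_projE ?(groupM gG p0G) ?(groupM gG' p0G) // !permM !p0E => E.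
have [k kK kE] := (vtx_eq gG gG').2 vE; have kf := eq_base_K12 kK kE.
have Ev : fvert (g f0) = fvert (g' f0) by rewrite kf (fvert_K12 _ kK).
have Ee : fedge (g f0) = fedge (g' f0) by rewrite !fedgeE Ev E.
have [/(etrans (esym kf)) E2|/(etrans (esym kf)) E2] := flag_vert_edge Ev Ee.
  rewrite (K12_free kK E2) mulg1 in kE.
  by apply: vtx_eq_base; rewrite ?(groupM gG p0G) ?(groupM gG' p0G) ?eq_base_mulr.
have kp2 : k = p2.
  have : (k * p2) (g f0) = g f0 by rewrite permM E2 p2E flip2K.
  move/(K12_free (groupM kK p2K12)) => H.
  by rewrite -[k]mulg1 -p2K mulgA H mul1g.
rewrite kp2 in kE.
(* [p2] commutes with [p0], so it can be moved past it and absorbed in the vertex class. *)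
rewrite -(vtx_K12 (groupM gG p0G) p2K12) -mulgA p02 mulgA.
apply: vtx_eq_base; rewrite ?(groupM gG' p0G) ?(groupM (groupM gG p2G) p0G) //.
exact: eq_base_mulr.
Qed.

Lemma cover_vertex_gt0 : 0 < #|{: cover_vertex}|.
Proof. by apply/card_gt0P; exists (vtx 1). Qed.

(** Along a word in the generators, [p1] and [p2] keep the vertex and [p0] moves it along an
    edge. *)
Lemma cover_connected (u v : cover_vertex) : connect (vertex_adj cover_faces) u v.
Proof.
have [g gG ->] := vtxP u; have [g' gG' ->] := vtxP v.
rewrite -[g'](mulKVg g); have : g^-1 * g' \in G by rewrite groupM ?groupV.
move: (g^-1 * g') => h hG.
elim/gen_indr: h / hG => [|h s hG]; first by rewrite mulg1 connect0.
have ghG := groupM gG hG; rewrite mulgA => sA cgh; apply: connect_trans cgh _; move: sA.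
rewrite !inE => /orP[/orP[]|] /eqP->.
- apply: connect1; rewrite /vertex_adj /= vtx_p0_neq //=.
  apply/bigcupP; exists (cover_face (g * h)); first exact: imset_f.
  by apply/imsetP; exists 1; rewrite ?group1 ?mulg1.
- by rewrite (vtx_K12 ghG p1K12) connect0.
- by rewrite (vtx_K12 ghG p2K12) connect0.
Qed.

Definition cover_map : polyhedral_map := lift_map cover_is_polygon cover_inj
  cover_image_face cover_star_inj cover_star_surj cover_nbr cover_vertex_gt0
  cover_connected.

(** * Automorphisms of the cover by precomposition *)

Section Translation.
Variable u : {perm flag X}.
Hypothesis uG : u \in G.
Hypothesis u_l : tau (u f0) = l.

Lemma translation_base f : tau f = l -> tau (u f) = l.
Proof. by move=> fl; rewrite -u_l; apply: tau_G; rewrite // fl. Qed.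

Lemma translation_baseV f : tau f = l -> tau (u^-1 f) = l.
Proof.
move=> fl; rewrite -[RHS]f0_l -[f0 in RHS](permK u); apply: tau_G.
  by rewrite groupV.
by rewrite fl u_l.
Qed.

Definition translation (v : cover_vertex) := vtx (u * repr (val v)).

Lemma translationE g : g \in G -> translation (vtx g) = vtx (u * g).
Proof.
move=> gG; rewrite /translation (vtxK gG).
have := mem_repr _ (mem_vclass gG); rewrite inE => /andP[rG /existsP[k]].
move: (repr _) rG => g' gG' /andP[kK /eq_baseP E].
symmetry; apply/vtx_eq; rewrite ?groupM //; exists k => //.
apply/eq_baseP=> f /translation_base fl.
by rewrite -mulgA [LHS]permM E // [RHS]permM.
Qed.

Lemma translation_inj : injective translation.
Proof.
move=> v v'; have [g gG ->] := vtxP v; have [g' gG' ->] := vtxP v'.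
rewrite !translationE // => /(vtx_eq (groupM uG gG) (groupM uG gG'))[k kK].
move=> /eq_baseP E; apply/vtx_eq => //; exists k => //; apply/eq_baseP=> f fl.
have := E _ (translation_baseV fl).
by rewrite !permM permKV.
Qed.

Lemma translation_automorphism : automorphism (translation : cover_map -> cover_map).
Proof.
apply: injective_automorphism => [|F]; first exact: translation_inj.
case/imsetP=> g gG ->; apply/imsetP; exists (u * g); first exact: groupM.
rewrite /face_image /cover_face -imset_comp; apply: eq_in_imset => k kK /=.
have gkG := groupM gG (K01_G kK).
by rewrite edge_image2 !translationE ?(groupM gkG p0G) // !mulgA.
Qed.
End Translation.

Lemma cover_vertex_transitive : vertex_transitive cover_map.
Proof.
move=> v v'; have [g gG ->] := vtxP v; have [g' gG' ->] := vtxP v'.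
(* Since [l] occurs at every vertex, each vertex class has a representative that sends [f0] to a
   flag with label [l]. *)
have base h : h \in G -> exists2 k, k \in K12 & tau ((h * k) f0) = l.
  move=> hG; have [f fv fl] := tau_vert (fvert (h f0)).
  by have [k kK kE] := K12_trans (esym fv); exists k; rewrite // permM kE.
have [k kK kl] := base g gG; have [k' kK' kl'] := base g' gG'.
have gkG := groupM gG (K12_G kK); have gkG' := groupM gG' (K12_G kK').
(* Chosen so that [u * (g * k) = g' * k']. It preserves label [l] because both factors send [f0] to
   label [l]. *)
set u := (g' * k') * (g * k)^-1.
have uG : u \in G by rewrite groupM ?groupV.
have ul : tau (u f0) = l.
  rewrite permM -[RHS]f0_l -[f0 in RHS](permK (g * k)); apply: tau_G.
    by rewrite groupV.
  by rewrite kl kl'.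
exists (translation u); first exact: translation_automorphism.
rewrite -(vtx_K12 gG kK) (translationE uG ul gkG) /u mulgKV.
exact: vtx_K12.
Qed.
End Cover.

Lemma vertex_transitive_cover (X : polyhedral_map) (t : seq nat) (T : eqType)
    (tau : flag X -> T) (l : T) :
  (forall x : X, has_vertex_type x t) -> orientable X ->
  (forall f g, tau f = tau g -> tau (flip0 f) = tau (flip0 g)) ->
  (forall f g, tau f = tau g -> tau (flip1 f) = tau (flip1 g)) ->
  (forall f g, tau f = tau g -> tau (flip2 f) = tau (flip2 g)) ->
  (forall f g, tau f = tau g -> #|fface f| = #|fface g|) ->
  (forall x, exists2 f, fvert f = x & tau f = l) ->
  exists (Y : polyhedral_map) (eta : Y -> X),
    [/\ orientable Y, vertex_transitive Y, covering eta &
        forall y : Y, has_vertex_type y t].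
Proof.
move=> X_type X_or tau0 tau1 tau2 tau_face tau_vert.
have /card_gt0P[x _] := map_nonempty X; have [f0 _ f0_l] := tau_vert x.
exists (cover_map X_type tau0 tau1 tau2 tau_face f0_l).
exists (cover_proj (tau := tau) (l := l) f0); split.
- exact: lift_orientable.
- exact: cover_vertex_transitive.
- exact: lift_covering.
- by move=> y; apply: lift_vertex_type.
Qed.

(** * Euler characteristic and vertex types *)

Section Euler.
Import GRing.Theory Num.Theory.
Local Open Scope ring_scope.
Variables (X : polyhedral_map) (t : seq nat).
Hypothesis X_type : forall x : X, has_vertex_type x t.

(** Weighted double counting of incident vertex-face pairs. The weight [1 / p] counts the faces, the
    weight [1] twice the edges. *)
Lemma sum_faces_type (phi : nat -> rat) :
  \sum_(F in faces X) #|F|%:R * phi #|F| = #|X|%:R * \sum_(p <- t) phi p.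
Proof.
transitivity (\sum_(F in faces X) \sum_(x in cover F) phi #|F|).
  by apply: eq_bigr => F FX; rewrite sumr_const card_cover_face // mulr_natl.
rewrite (exchange_big_dep predT) //=.
transitivity (\sum_(x : X) \sum_(p <- t) phi p); last first.
  by rewrite sumr_const mulr_natl.
apply: eq_bigr => x _; have [s [_ U sE _] ->] := X_type x.
rewrite big_map big_uniq //=; apply: eq_bigl => F.
by rewrite sE inE.
Qed.

Lemma sum_faces_edges : (\sum_(F in faces X) #|F| = 2 * #|edges X|)%N.
Proof.
transitivity (\sum_(F in faces X) \sum_(e in F) 1)%N.
  by apply: eq_bigr => F _; rewrite sum1_card.
rewrite (exchange_big_dep (mem (edges X))) /=; last first.
  by move=> F e FX eF; apply/bigcupP; exists F.
rewrite (eq_bigr (fun=> 2)); first by rewrite sum_nat_const mulnC.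
by move=> e eX; rewrite sum1dep_card (edge_two_faces eX).
Qed.

Lemma face_size_ge3 F : F \in faces X -> (3 <= #|F|)%N.
Proof. by case/faces_polygon=> s [s3 U ->]; rewrite card_polygon. Qed.

Lemma vertex_type_ge3 : all (leq 3) t.
Proof.
have /card_gt0P[x _] := map_nonempty X; have [s [_ _ sE _] ->] := X_type x.
apply/allP=> _ /mapP[F Fs ->]; apply: face_size_ge3.
by move: Fs; rewrite sE inE => /andP[].
Qed.

Lemma euler_char_type : (euler_char X)%:~R =
  #|X|%:R * (1 - (size t)%:R / 2 + \sum_(p <- t) p%:R^-1) :> rat.
Proof.
have FE : #|faces X|%:R = #|X|%:R * \sum_(p <- t) p%:R^-1 :> rat.
  rewrite -sum_faces_type -sum1_card natr_sum; apply: eq_bigr => F /face_size_ge3 F3.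
  by rewrite mulfV // pnatr_eq0 -lt0n; apply: leq_trans F3.
have EE : 2 * #|edges X|%:R = #|X|%:R * (size t)%:R :> rat.
  rewrite -natrM -sum_faces_edges natr_sum.
  have := sum_faces_type (fun=> 1); rewrite big_const_seq count_predT iter_addr_0.
  by move=> <-; apply: eq_bigr => F _; rewrite mulr1.
rewrite /euler_char rmorphD rmorphB /= -!pmulrn FE.
by lra.
Qed.

End Euler.

(** * Solutions of [d/2 - 1 = 1/p_1 + ... + 1/p_d] *)

Section Arithmetic.
Import Order.TTheory GRing.Theory Num.Theory.
Local Open Scope ring_scope.

Lemma invn_le (n p : nat) : (0 < n)%N -> (n <= p)%N ->
  0 < p%:R^-1 :> rat /\ p%:R^-1 <= n%:R^-1 :> rat.
Proof.
move=> n0 np; have p0 := leq_trans n0 np.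
by rewrite invr_gt0 ltr0n p0 lef_pV2 ?posrE ?ltr0n // ler_nat.
Qed.

(** The nondecreasing solutions with more than three entries; length three is treated uniformly by
    [degree3_flip0]. *)
Definition flat_types : seq (seq nat) :=
  [:: [:: 3; 3; 4; 12]; [:: 3; 3; 6; 6]; [:: 3; 4; 4; 6]; [:: 4; 4; 4; 4];
      [:: 3; 3; 3; 3; 6]; [:: 3; 3; 3; 4; 4]; [:: 3; 3; 3; 3; 3; 3]].

Lemma eq_or_eqS (n m : nat) : (n <= m <= n.+1)%N -> m = n \/ m = n.+1.
Proof.
case/andP=> nm; rewrite leq_eqVlt => /predU1P[|]; first by right.
by rewrite ltnS => mn; left; apply/eqP; rewrite eqn_leq mn.
Qed.

Lemma flat4 (a b c e : nat) : (3 <= a <= b)%N -> (b <= c <= e)%N ->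
  1 - 4 / 2 + (a%:R^-1 + (b%:R^-1 + (c%:R^-1 + (e%:R^-1)))) = 0 :> rat ->
  [:: a; b; c; e] \in flat_types.
Proof.
move=> /andP[a3 ab] /andP[bc ce] E.
have b3 := leq_trans a3 ab; have c3 := leq_trans b3 bc; have e3 := leq_trans c3 ce.
have [a0 ai] := invn_le (isT : 0 < 3)%N a3.
have [b0 bi] := invn_le (isT : 0 < 3)%N b3.
have [c0 ci] := invn_le (isT : 0 < 3)%N c3.
have [e0 ei] := invn_le (isT : 0 < 3)%N e3.
(* Otherwise the sum is at most 1/3 + 3/5 < 1; likewise [c >= 7] would give at most 2/3 + 2/7 <
   1. *)
have b4 : (b <= 4)%N.
  rewrite leqNgt; apply/negP => b5.
  have [_ bi'] := invn_le (isT : 0 < 5)%N b5.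
  have [_ ci'] := invn_le (isT : 0 < 5)%N (leq_trans b5 bc).
  have [_ ei'] := invn_le (isT : 0 < 5)%N (leq_trans b5 (leq_trans bc ce)).
  by move: E ai bi' ci' ei'; clear; lra.
have c6 : (c <= 6)%N.
  rewrite leqNgt; apply/negP => c7.
  have [_ ci'] := invn_le (isT : 0 < 7)%N c7.
  have [_ ei'] := invn_le (isT : 0 < 7)%N (leq_trans c7 ce).
  by move: E ai bi ci' ei'; clear; lra.
have a4 := leq_trans ab b4.
have [_ ec] := invn_le (leq_trans (isT : 0 < 3)%N c3) ce.
have aP : a = 3 \/ a = 4 by apply: eq_or_eqS; rewrite a3.
have bP : b = 3 \/ b = 4 by apply: eq_or_eqS; rewrite b3.
have cP : [\/ c = 3, c = 4, c = 5 | c = 6].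
  have [c4|c5] := leqP c 4.
    have cP : c = 3 \/ c = 4 by apply: eq_or_eqS; rewrite c3 c4.
    by case: cP => ->; [constructor 1 | constructor 2].
  have cP : c = 5 \/ c = 6 by apply: eq_or_eqS; rewrite c5 c6.
  by case: cP => ->; [constructor 3 | constructor 4].
have eE (n : nat) : e%:R^-1 = n%:R^-1 :> rat -> e = n.
  by move/invr_inj/eqP; rewrite eqr_nat => /eqP.
(* After [3, 3, 5] the last entry would have to be 15/2. *)
have e15 : e%:R^-1 <> 2 / 15 :> rat.
  have [e7|e8] := leqP e 7.
    have [_ +] := invn_le (leq_trans (isT : 0 < 3)%N e3) e7.
    by clear; lra.
  by have [_ +] := invn_le (isT : 0 < 8)%N e8; clear; lra.
move: E ab bc ec e0 eE e15; clear -aP bP cP.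
case: aP bP cP => -> [] -> [] -> E ab bc ec e0 eE e15;
  try (by exfalso; move: ab; clear); try (by exfalso; move: bc; clear).
- by exfalso; move: E e0; clear; lra.
- by have -> : e = 12 by apply: eE; move: E; clear; lra.
- by exfalso; apply: e15; move: E; clear; lra.
- by have -> : e = 6 by apply: eE; move: E; clear; lra.
- by have -> : e = 6 by apply: eE; move: E; clear; lra.
- by exfalso; move: E ec; clear; lra.
- by exfalso; move: E ec; clear; lra.
- by have -> : e = 4 by apply: eE; move: E; clear; lra.
- by exfalso; move: E ec; clear; lra.
- by exfalso; move: E ec; clear; lra.
Qed.

Lemma flat5 (a b c d e : nat) : (3 <= a <= b)%N -> (b <= c <= d)%N -> (d <= e)%N ->
  1 - 5 / 2 + (a%:R^-1 + (b%:R^-1 + (c%:R^-1 + (d%:R^-1 + e%:R^-1)))) = 0 :> rat ->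
  [:: a; b; c; d; e] \in flat_types.
Proof.
move=> /andP[a3 ab] /andP[bc cd] de E.
have b3 := leq_trans a3 ab; have c3 := leq_trans b3 bc; have d3 := leq_trans c3 cd.
have e3 := leq_trans d3 de.
have [a0 ai] := invn_le (isT : 0 < 3)%N a3.
have [b0 bi] := invn_le (isT : 0 < 3)%N b3.
have [c0 ci] := invn_le (isT : 0 < 3)%N c3.
have [d0 di] := invn_le (isT : 0 < 3)%N d3.
have [e0 ei] := invn_le (isT : 0 < 3)%N e3.
(* Otherwise the sum is at most 2/3 + 3/4 < 3/2; likewise [d >= 5] would give at most 1 + 2/5. *)
have c4 : (c <= 3)%N.
  rewrite leqNgt; apply/negP => c4.
  have [_ ci'] := invn_le (isT : 0 < 4)%N c4.
  have [_ di'] := invn_le (isT : 0 < 4)%N (leq_trans c4 cd).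
  have [_ ei'] := invn_le (isT : 0 < 4)%N (leq_trans c4 (leq_trans cd de)).
  by move: E ai bi ci' di' ei'; clear; lra.
have d4 : (d <= 4)%N.
  rewrite leqNgt; apply/negP => d5.
  have [_ di'] := invn_le (isT : 0 < 5)%N d5.
  have [_ ei'] := invn_le (isT : 0 < 5)%N (leq_trans d5 de).
  by move: E ai bi ci di' ei'; clear; lra.
have b4 := leq_trans bc c4; have a4 := leq_trans ab b4.
have aE : a = 3 by apply/eqP; rewrite eqn_leq a3 a4.
have bE : b = 3 by apply/eqP; rewrite eqn_leq b3 b4.
have cE : c = 3 by apply/eqP; rewrite eqn_leq c3 c4.
subst a b c.
have dP : d = 3 \/ d = 4 by apply: eq_or_eqS; rewrite d3.
have eE (n : nat) : e%:R^-1 = n%:R^-1 :> rat -> e = n.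
  by move/invr_inj/eqP; rewrite eqr_nat => /eqP.
move: E eE; clear -dP; case: dP => -> E eE.
  by have -> : e = 6 by apply: eE; move: E; clear; lra.
by have -> : e = 4 by apply: eE; move: E; clear; lra.
Qed.

Lemma sum_invn_le (u : seq nat) : all (leq 3) u ->
  \sum_(p <- u) p%:R^-1 <= (size u)%:R / 3 :> rat.
Proof.
elim: u => [|p v IH] /=; first by rewrite big_nil mul0r.
case/andP=> p3 v3; have [_ pi] := invn_le (isT : 0 < 3)%N p3.
by move: (IH v3) pi; rewrite big_cons -natr1; clear; lra.
Qed.

Lemma flat_sorted (t : seq nat) : sorted leq t -> all (leq 3) t ->
  1 - (size t)%:R / 2 + \sum_(p <- t) p%:R^-1 = 0 :> rat ->
  size t = 3 \/ t \in flat_types.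
Proof.
case: t => [|a [|b [|c [|d [|e [|f [|g t]]]]]]]; rewrite ?big_cons ?big_nil ?addr0 /=.
- by move=> _ _ E; exfalso; move: E; lra.
- move=> _ /andP[a3 _]; have [a0 _] := invn_le (isT : 0 < 3)%N a3.
  by move=> E; exfalso; move: E a0; clear; lra.
- move=> _ /and3P[a3 b3 _]; have [a0 _] := invn_le (isT : 0 < 3)%N a3.
  have [b0 _] := invn_le (isT : 0 < 3)%N b3.
  by move=> E; exfalso; move: E a0 b0; clear; lra.
- by left.
- case/and4P=> ab bc cd _ /andP[a3 _] E; right.
  by apply: flat4 E; rewrite ?a3 ?bc.
- case/and5P=> ab bc cd de _ /andP[a3 _] E; right.
  by apply: flat5 E; rewrite ?a3 ?bc.
- case/and5P=> ab bc cd de /andP[ef _] /andP[a3 _] E; right.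
  have b3 := leq_trans a3 ab; have c3 := leq_trans b3 bc; have d3 := leq_trans c3 cd.
  have e3 := leq_trans d3 de; have f3 := leq_trans e3 ef.
  have [a0 ai] := invn_le (isT : 0 < 3)%N a3.
  have [b0 bi] := invn_le (isT : 0 < 3)%N b3.
  have [c0 ci] := invn_le (isT : 0 < 3)%N c3.
  have [d0 di] := invn_le (isT : 0 < 3)%N d3.
  have [e0 ei] := invn_le (isT : 0 < 3)%N e3.
  have f4 : (f <= 3)%N.
    rewrite leqNgt; apply/negP => f4; have [_ fi] := invn_le (isT : 0 < 4)%N f4.
    by move: E ai bi ci di ei fi; clear; lra.
  have e4 := leq_trans ef f4; have d4 := leq_trans de e4; have c4 := leq_trans cd d4.
  have b4 := leq_trans bc c4; have a4 := leq_trans ab b4.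
  have E3 n : (3 <= n)%N -> (n <= 3)%N -> n = 3.
    by move=> n3 n4; apply/eqP; rewrite eqn_leq n3 n4.
  by rewrite (E3 a a3 a4) (E3 b b3 b4) (E3 c c3 c4) (E3 d d3 d4) (E3 e e3 e4)
     (E3 f f3 f4).
(* For [n >= 7] entries, [n / 3 < n / 2 - 1]. *)
- move=> _ A E; exfalso; move: E; set u := [:: a, b, c, d, e, f, g & t] in A *.
  have -> : a%:R^-1 + (b%:R^-1 + (c%:R^-1 + (d%:R^-1 + (e%:R^-1 + (f%:R^-1 +
     (g%:R^-1 + \sum_(j <- t) j%:R^-1)))))) = \sum_(p <- u) p%:R^-1 :> rat.
    by rewrite !big_cons.
  have B := @sum_invn_le u A.
  have S : 7 <= (size u)%:R :> rat by rewrite ler_nat.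
  rewrite -[(size t).+1.+1.+1.+1.+1.+1.+1]/(size u).
  by move: B S; clear; lra.
Qed.

Lemma flat_vertex_type (t : seq nat) : all (leq 3) t ->
  1 - (size t)%:R / 2 + \sum_(p <- t) p%:R^-1 = 0 :> rat ->
  size t = 3 \/ exists2 u, u \in flat_types & t \in permutations u.
Proof.
move=> t3 E; have pE : perm_eq (sort leq t) t by rewrite perm_sort.
have [| |//|S3|F] := @flat_sorted (sort leq t).
- by apply: sort_sorted; apply: leq_total.
- by rewrite (perm_all _ pE).
- by rewrite size_sort (perm_big _ pE).
- by left; rewrite -(size_sort leq).
- by right; exists (sort leq t); rewrite // mem_permutations perm_sym.
Qed.
End Arithmetic.

(** * Types whose words determine the labels *)

(* If [u] is the word of a flag [f] in a triangle and [v] that of [flip0 f], some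
   word [z] occurs at the third corner, and the sizes of the two faces across
   its sides are the second entries of [u] and [v]. *)
Definition triangle_compatible (C : seq (seq nat)) (u v : seq nat) :=
  (head 0 u == 3) ==>
  has (fun z => [&& head 0 z == 3, last 0 z == nth 0 u 1 &
                    nth 0 z 1 == nth 0 v 1]) C.

Definition edge_compatible (C : seq (seq nat)) (u v : seq nat) :=
  [&& head 0 u == head 0 v, last 0 u == last 0 v, triangle_compatible C u v &
      triangle_compatible C (rev u) (rev v)].

(* Either the word of [f] determines that of [flip0 f] outright, or it does so
   because [flip0] maps the flags with some other word onto those with word
   [u], all words being equally frequent. *)
Definition determined_type (t : seq nat) :=
  let C := word_class t in
  all (fun u => has (fun u' =>
    all (fun v => edge_compatible C u v ==> (v == u')) C ||
    all (fun v => edge_compatible C u' v ==> (v == u)) C) C) C.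

Section Labels.
Variables (X : polyhedral_map) (t : seq nat).
Hypothesis X_type : forall x : X, has_vertex_type x t.
Local Notation d := (size t).
Local Notation w := (@vert_word X d).
Implicit Types f g : flag X.

Hypothesis d_gt1 : 1 < d.

Lemma word_head f : head 0 (w f) = #|fface f|.
Proof. by rewrite -nth0 nth_mkseq // ltnW. Qed.

Lemma word_nth1 f : nth 0 (w f) 1 = #|fface (vert_step f)|.
Proof. by rewrite nth_mkseq. Qed.

Lemma word_last f : last 0 (w f) = #|fface (flip2 f)|.
Proof.
by rewrite -word_head (word_flip2 X_type) -nth_last -nth0 nth_rev ?size_mkseq ?subn1 // ltnW.
Qed.

(** Three turns about a triangle are the identity, which amounts to the braid relation between
    [flip0] and [flip1]. *)
Lemma triangle_flips f : #|fface f| = 3 ->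
  flip1 (flip0 (flip1 f)) = flip0 (flip1 (flip0 f)).
Proof.
move=> f3; have [_ _ + _] := face_walk f; rewrite f3 /= /face_step => E.
by rewrite -[f in LHS]E !flip1K flip0K flip1K.
Qed.

Lemma flip0_edge_compatible C f : (forall g, w g \in C) ->
  edge_compatible C (w f) (w (flip0 f)).
Proof.
move=> wC.
have tri g : triangle_compatible C (w g) (w (flip0 g)).
  apply/implyP; rewrite word_head => /eqP g3.
  (* The flag at the third corner whose edge leads back to the vertex of [g]. *)
  apply/hasP; exists (w (flip0 (flip1 g))) => //.
  rewrite word_head word_last !word_nth1 g3 eqxx -flip02 /=.
  by rewrite /vert_step triangle_flips // -flip02 !eqxx.
rewrite /edge_compatible !word_head !word_last -flip02 !eqxx tri /=.
by rewrite -!(word_flip2 X_type) -flip02 tri.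
Qed.

Definition word_flags u := [set f : flag X | w f == u].

Lemma card_word_rev u : #|word_flags u| <= #|word_flags (rev u)|.
Proof.
rewrite -(card_imset _ (inv_inj (@flip2K X))); apply/subset_leq_card/subsetP.
by move=> _ /imsetP[f + ->]; rewrite !inE (word_flip2 X_type) => /eqP->.
Qed.

Lemma card_word_rot u i : i <= d -> #|word_flags u| <= #|word_flags (rot i u)|.
Proof.
move=> id; have inj : injective (iter i (@vert_step X)).
  by elim: (i) => //= j IH f g /vert_step_inj /IH.
rewrite -(card_imset _ inj); apply/subset_leq_card/subsetP.
by move=> _ /imsetP[f + ->]; rewrite !inE (word_iter X_type) // => /eqP->.
Qed.

(** [vert_step] and [flip2] are injective on flags and rotate and reverse the words. *)
Lemma card_word_class u : u \in word_class t -> #|word_flags u| = #|word_flags t|.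
Proof.
have rotP i : i <= d -> #|word_flags (rot i t)| = #|word_flags t|.
  move=> id; apply/eqP; rewrite eqn_leq card_word_rot // andbT.
  have := card_word_rot (rot i t) (leq_subr i d).
  by rewrite -{1}(size_rot i t) -/(rotr i _) rotK.
rewrite mem_cat => /orP[] /mapP[i]; rewrite mem_iota add0n ltnS => /= id ->.
  exact: rotP.
rewrite -(rotP i id); apply/eqP; rewrite eqn_leq card_word_rev andbT.
by rewrite -{2}(revK (rot i t)) card_word_rev.
Qed.

(** An injection between sets of equal size is onto, and [flip0] is its own inverse. *)
Lemma flip0_word_swap u v : #|word_flags u| = #|word_flags v| ->
  (forall f, w f = u -> w (flip0 f) = v) -> forall f, w f = v -> w (flip0 f) = u.
Proof.
move=> E uv f fv.
have EE : @flip0 X @: word_flags u = word_flags v.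
  apply/eqP; rewrite eqEcard (card_imset _ (inv_inj (@flip0K X))) E leqnn andbT.
  by apply/subsetP=> _ /imsetP[g + ->]; rewrite !inE => /eqP/uv->.
have : f \in word_flags v by rewrite inE fv.
by rewrite -EE => /imsetP[g + ->]; rewrite inE flip0K => /eqP.
Qed.

Lemma determined_flip0 : determined_type t ->
  forall f g, w f = w g -> w (flip0 f) = w (flip0 g).
Proof.
move=> tD f g fg; have wC := mem_word_class X_type.
have /hasP[u' u'C uu'] := allP tD _ (wC f).
suff H h : w h = w f -> w (flip0 h) = u' by rewrite !H.
move=> hf; case/orP: uu' => /allP H.
  by have /implyP/(_ _)/eqP := H _ (wC (flip0 h)); apply; rewrite -hf flip0_edge_compatible.
apply: (flip0_word_swap (u := u')) hf; first by rewrite !card_word_class.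
move=> k ku; have /implyP/(_ _)/eqP := H _ (wC (flip0 k)); apply.
by rewrite -ku flip0_edge_compatible.
Qed.

(** First and last entries agree across an edge, and all words have the same sum, so the middle
    entries agree too. *)
Lemma degree3_flip0 : d = 3 -> forall f, w (flip0 f) = w f.
Proof.
move=> d3 f; have wC := mem_word_class X_type.
have sumC u : u \in word_class t -> sumn u = sumn t.
  rewrite mem_cat => /orP[] /mapP[i _ ->]; rewrite ?sumn_rev //.
    by apply: perm_sumn; rewrite perm_rot.
  by apply: perm_sumn; rewrite perm_rot.
have := flip0_edge_compatible f wC; rewrite /edge_compatible.
have := sumC _ (wC (flip0 f)); rewrite -(sumC _ (wC f)).
have: size (w f) = 3 by rewrite size_mkseq.
have: size (w (flip0 f)) = 3 by rewrite size_mkseq.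
case: (w f) => [|a [|b [|c []]]] //; case: (w (flip0 f)) => [|a' [|b' [|c' []]]] //=.
move=> _ _ E /and3P[/eqP aa /eqP cc _]; subst a' c'.
by move: E => /eqP; rewrite eqn_add2l !addn0 eqn_add2r => /eqP->.
Qed.

Lemma word_label_cover : orientable X ->
  (forall f g, w f = w g -> w (flip0 f) = w (flip0 g)) ->
  exists (Y : polyhedral_map) (eta : Y -> X),
    [/\ orientable Y, vertex_transitive Y, covering eta &
        forall y : Y, has_vertex_type y t].
Proof.
move=> X_or w0; apply: (vertex_transitive_cover (tau := w) (l := t)) => //.
- by move=> f g E; rewrite !(word_flip1 X_type) E.
- by move=> f g E; rewrite !(word_flip2 X_type) E.
- by move=> f g E; rewrite -!word_head E.
- by move=> x; have [f [fx fw _ _ _]] := base_flag X_type x; exists f.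
Qed.
End Labels.

Definition snub_words : seq (seq nat) :=
  [:: [:: 3; 3; 3; 3; 6]; [:: 3; 3; 3; 6; 3]; [:: 3; 3; 6; 3; 3];
      [:: 3; 6; 3; 3; 3]; [:: 6; 3; 3; 3; 3]].

Lemma flat_types_determined u t : u \in flat_types -> t \in permutations u ->
  determined_type t \/ t \in snub_words.
Proof.
move=> uF tu; apply/orP.
have : all (fun u => all (fun t => determined_type t || (t \in snub_words))
  (permutations u)) flat_types by vm_compute.
by move/allP/(_ u uF)/allP/(_ t tu).
Qed.

(** * The snub hexagonal type *)

Section Snub.
Variables (X : polyhedral_map) (t : seq nat).
Hypothesis X_type : forall x : X, has_vertex_type x t.
Hypothesis t_snub : t \in snub_words.
Local Notation w := (@vert_word X (size t)).
Implicit Types f g : flag X.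

(** A flag with word [wd] lies in the hexagon, one with word [we] in a triangle with the hexagon
    across its edge; for the other three the edge lies between two triangles. *)
Local Notation wa := [:: 3; 3; 3; 6; 3].
Local Notation wb := [:: 3; 3; 6; 3; 3].
Local Notation wc := [:: 3; 6; 3; 3; 3].
Local Notation wd := [:: 6; 3; 3; 3; 3].
Local Notation we := [:: 3; 3; 3; 3; 6].

Lemma snub_size : size t = 5.
Proof.
by have /allP/(_ t t_snub)/eqP : all (fun u => size u == 5) snub_words by [].
Qed.

Lemma snub_size_gt1 : 1 < size t. Proof. by rewrite snub_size. Qed.

Lemma snub_word f : w f \in snub_words.
Proof.
have : all (fun t => all (fun u => u \in snub_words) (word_class t)) snub_words.
  by vm_compute.
by move/allP/(_ t t_snub)/allP/(_ _ (mem_word_class X_type f)).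
Qed.

Lemma snub_word_cases f (P : Prop) :
  (w f = wa -> P) -> (w f = wb -> P) -> (w f = wc -> P) -> (w f = wd -> P) ->
  (w f = we -> P) -> P.
Proof.
by move=> *; have := snub_word f; rewrite !inE => /or4P[| | |/orP[]] /eqP; auto.
Qed.

(** What local compatibility leaves open; the pair [(wb, wb)] is excluded only later, by the
    counting in [snub_b]. *)
Definition snub_pairs :=
  [:: (wa, wb); (wa, wc); (wb, wa); (wb, wb); (wb, wc); (wc, wa); (wc, wb);
      (wd, wd); (we, we)].

Lemma snub_pair f : (w f, w (flip0 f)) \in snub_pairs.
Proof.
have : all (fun u => all (fun v =>
    edge_compatible snub_words u v ==> ((u, v) \in snub_pairs)) snub_words) snub_words.
  by vm_compute.
move/allP/(_ _ (snub_word f))/allP/(_ _ (snub_word (flip0 f)))/implyP; apply.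
exact: (flip0_edge_compatible X_type snub_size_gt1 _ snub_word).
Qed.

Lemma word1 f : w (flip1 f) = rev (rot 1 (w f)). Proof. exact: word_flip1. Qed.
Lemma word2 f : w (flip2 f) = rev (w f). Proof. exact: word_flip2. Qed.
Lemma word02 f : w (flip0 (flip2 f)) = rev (w (flip0 f)).
Proof. by rewrite flip02 word2. Qed.

Lemma snub_c f : w f = wc -> w (flip0 f) = wa \/ w (flip0 f) = wb.
Proof.
move=> fw; have /allP/(_ _ (snub_pair f)) : all (fun p => (p.1 == wc) ==>
  ((p.2 == wa) || (p.2 == wb))) snub_pairs by [].
by rewrite [(_, _).1]/= [(_, _).2]/= fw eqxx => /orP[] /eqP; [left | right].
Qed.

Lemma snub_a f : w f = wa -> w (flip0 f) = wb \/ w (flip0 f) = wc.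
Proof.
move=> fw; have /allP/(_ _ (snub_pair f)) : all (fun p => (p.1 == wa) ==>
  ((p.2 == wb) || (p.2 == wc))) snub_pairs by [].
by rewrite [(_, _).1]/= [(_, _).2]/= fw eqxx => /orP[] /eqP; [left | right].
Qed.

Lemma snub_d f : w f = wd -> w (flip0 f) = wd.
Proof.
move=> fw; have /allP/(_ _ (snub_pair f)) : all (fun p => (p.1 == wd) ==>
  (p.2 == wd)) snub_pairs by [].
by rewrite [(_, _).1]/= [(_, _).2]/= fw eqxx => /eqP.
Qed.

Lemma snub_e f : w f = we -> w (flip0 f) = we.
Proof.
move=> fw; have /allP/(_ _ (snub_pair f)) : all (fun p => (p.1 == we) ==>
  (p.2 == we)) snub_pairs by [].
by rewrite [(_, _).1]/= [(_, _).2]/= fw eqxx => /eqP.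
Qed.

Lemma snub_triangle f : head 0 (w f) = 3 ->
  flip1 (flip0 (flip1 f)) = flip0 (flip1 (flip0 f)).
Proof. by rewrite (word_head snub_size_gt1); apply: triangle_flips. Qed.

(* The reflection of a triangle with one side on a hexagon. *)
Definition mirror f := flip1 (flip0 (flip1 f)).

Lemma mirrorK : involutive mirror.
Proof. by move=> f; rewrite /mirror flip1K flip0K flip1K. Qed.

(** [flip1 f] has word [we], and [flip0] preserves that word. *)
Lemma mirror_c f : w f = wc ->
  w (mirror f) = wc /\ flip0 (mirror f) = flip1 (flip0 f).
Proof.
move=> fw; split; last by rewrite /mirror snub_triangle ?fw // flip0K.
by rewrite /mirror word1 snub_e // word1 fw.
Qed.

(* Each flag with word [wc] gives rise to one with word [wb] that [flip0] does
   not map to word [wb]; by counting, these are all the flags with word [wb]. *)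
Lemma snub_b f : w f = wb -> w (flip0 f) = wa \/ w (flip0 f) = wc.
Proof.
(* In the second case [flip0 g] has word [wa], so [flip0 (mirror g) = flip1 (flip0 g)] has word
   [wb]. The extra [flip2] makes [flip0 (psi g)] have word [wa] instead of [wc], which keeps the two
   branches apart. *)
pose psi g := if w (flip0 g) == wb then flip0 g else flip0 (flip2 (mirror g)).
have psiP g : w g = wc -> w (psi g) = wb /\
    w (flip0 (psi g)) = if w (flip0 g) == wb then wc else wa.
  move=> gw; rewrite /psi; case: eqP => [->|gb]; first by rewrite flip0K.
  have [//|ga] := snub_c gw; last by [].
  move=> ga; have [mw mE] := mirror_c gw.
  by rewrite word02 flip0K word2 mw mE word1 ga.
have psi_inj : {in word_flags X t wc &, injective psi}.
  move=> g h; rewrite !inE => /eqP gw /eqP hw E.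
  have := (psiP g gw).2; rewrite E (psiP h hw).2.
  move: E; rewrite /psi; do 2!case: eqP => _ //.
    by move/(inv_inj (@flip0K X)).
  by move/(inv_inj (@flip0K X))/(inv_inj (@flip2K X))/(inv_inj mirrorK).
have wbE : psi @: word_flags X t wc = word_flags X t wb.
  apply/eqP; rewrite eqEcard (card_in_imset psi_inj).
  have C u : u \in snub_words -> u \in word_class t.
    move=> us; have : all (fun t => all (fun u => u \in word_class t) snub_words) snub_words.
      by vm_compute.
    by move/allP/(_ t t_snub)/allP/(_ u us).
  rewrite !(card_word_class X_type) ?C // leqnn andbT.
  apply/subsetP=> _ /imsetP[g + ->]; rewrite !inE => /eqP/psiP[-> _].
  by rewrite eqxx.
move=> fw; have : f \in word_flags X t wb by rewrite inE fw.
rewrite -wbE => /imsetP[g + ->]; rewrite inE => /eqP/psiP[_ ->].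
by case: ifP; [right | left].
Qed.

(** If one of [flip0 f] and [flip0 (flip1 f)] has word [wc], then [mirror] takes it to the other,
    which has word [wc] too. *)
Lemma snub_ab f : w f = wa ->
  (w (flip0 f) == wb) = (w (flip0 (flip1 f)) == wa).
Proof.
move=> fw; have f1w : w (flip1 f) = wb by rewrite word1 fw.
have [fb|fc] := snub_a fw.
  rewrite fb eqxx; have [->//|f1c] := snub_b f1w.
  have [mw mE] := mirror_c f1c; move: mE; rewrite flip0K flip1K => mE.
  by move: fb; rewrite -mE flip0K mw.
rewrite fc; have [mw mE] := mirror_c fc; move: mE; rewrite flip0K => mE.
by rewrite -mE flip0K mw.
Qed.

(* The snub tiling is chiral: [chirality] tells the two mirror images of the
   star of a vertex apart, as seen from a flag. *)
Definition chirality f : bool :=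
  let u := w f in
  if u == wc then w (flip0 f) == wa
  else if u == wa then w (flip0 f) == wb
  else if u == wb then w (flip0 f) == wc
  else if u == we then w (flip0 (flip1 f)) == wb
  else w (flip0 (flip1 (flip2 f))) == wa.

Lemma chirality2 f : chirality (flip2 f) = ~~ chirality f.
Proof.
apply: (@snub_word_cases f) => fw; rewrite /chirality word2 fw /= ?word02 ?flip2K.
- by have [->|->] := snub_a fw.
- by have [->|->] := snub_b fw.
- by have [->|->] := snub_c fw.
- have f12 : w (flip1 (flip2 f)) = wc by rewrite word1 word2 fw.
  by have [->|->] := snub_c f12.
- have f1 : w (flip1 f) = wc by rewrite word1 fw.
  by have [->|->] := snub_c f1.
Qed.

Lemma chirality1_nd f : w f != wd -> chirality (flip1 f) = ~~ chirality f.
Proof.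
move=> fd; apply: (@snub_word_cases f) => fw; rewrite /chirality word1 fw /= ?flip1K.
- have := snub_ab fw; have f1 : w (flip1 f) = wb by rewrite word1 fw.
  by have [->|->] := snub_b f1 => ->.
- have f1 : w (flip1 f) = wa by rewrite word1 fw.
  have := snub_ab f1; rewrite flip1K.
  by have [->|->] := snub_b fw => ->.
- by have [->|->] := snub_c fw.
- by rewrite fw in fd.
- have f1 : w (flip1 f) = wc by rewrite word1 fw.
  by have [->|->] := snub_c f1.
Qed.

Lemma chirality1 f : chirality (flip1 f) = ~~ chirality f.
Proof.
have [fw|] := eqVneq (w f) wd; last exact: chirality1_nd.
(* Across the hexagon: go the other way around the vertex instead. *)
have -> : flip1 f =
    flip2 (flip1 (flip2 (flip1 (flip2 (flip1 (flip2 (flip1 (flip2 f)))))))).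
  rewrite -[f in RHS](vert_step_degree X_type f) snub_size /= /vert_step.
  by rewrite !(flip2K, flip1K).
by rewrite !(chirality2, chirality1_nd) ?negbK // !(word1, word2) fw.
Qed.

Lemma chirality0 f : chirality (flip0 f) = ~~ chirality f.
Proof.
have E0 g : w g = we -> chirality (flip0 g) = ~~ chirality g.
  move=> gw; have g1 : w (flip1 g) = wc by rewrite word1 gw.
  (* The reflection in the triangle exchanges the ends of its hexagon side, and [flip1] exchanges
     the words [wa] and [wb]. *)
  have [_] := mirror_c g1; rewrite /mirror flip1K => mE.
  rewrite /chirality gw (snub_e gw) /= mE word1.
  by have [->|->] := snub_c g1.
apply: (@snub_word_cases f) => fw; last exact: E0.
- have [f0|f0] := snub_a fw; rewrite /chirality f0 fw flip0K fw //.
- have [f0|f0] := snub_b fw; rewrite /chirality f0 fw flip0K fw //.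
- have [f0|f0] := snub_c fw; rewrite /chirality f0 fw flip0K fw //.
(* A flag in the hexagon is handled through [flip2], which turns [wd] into [we] and commutes with
   [flip0]. *)
- by rewrite -[flip0 f]flip2K chirality2 -flip02 E0 ?chirality2 ?word2 ?fw // negbK.
Qed.

(** [chirality] selects one of the two words that [snub_a], [snub_b] and [snub_c] leave possible. *)
Lemma snub_flip0 f g : w f = w g -> chirality f = chirality g ->
  w (flip0 f) = w (flip0 g).
Proof.
rewrite /chirality; apply: (@snub_word_cases f) => fw fg; rewrite -fg fw /=;
  have gw := etrans (esym fg) fw.
- by have [->|->] := snub_a fw; have [->|->] := snub_a gw.
- by have [->|->] := snub_b fw; have [->|->] := snub_b gw.
- by have [->|->] := snub_c fw; have [->|->] := snub_c gw.
- by rewrite (snub_d fw) (snub_d gw).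
- by rewrite (snub_e fw) (snub_e gw).
Qed.

Lemma snub_cover : orientable X ->
  exists (Y : polyhedral_map) (eta : Y -> X),
    [/\ orientable Y, vertex_transitive Y, covering eta &
        forall y : Y, has_vertex_type y t].
Proof.
move=> X_or.
apply: (vertex_transitive_cover (tau := fun f => (w f, chirality f)) (l := (wc, true))) => //.
- move=> f g [fg cfg]; rewrite !chirality0 cfg; congr (_, _); exact: snub_flip0.
- by move=> f g [fg cfg]; rewrite !chirality1 cfg !word1 fg.
- by move=> f g [fg cfg]; rewrite !chirality2 cfg !word2 fg.
- by move=> f g [fg _]; rewrite -!(word_head snub_size_gt1) fg.
- move=> x; have [f fx fc] : exists2 f, fvert f = x & w f = wc.
    have [f [fx _ _ _ _]] := base_flag X_type x.
    have rotw i : i <= 5 -> w (iter i (@vert_step X) f) = rot i (w f).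
      by rewrite -snub_size => id; apply: word_iter.
    have rc : all (fun u => has (fun i => rot i u == wc) (iota 0 5)) snub_words.
      by vm_compute.
    have /hasP[i] := allP rc _ (snub_word f); rewrite mem_iota => /= i5 /eqP E.
    by exists (iter i (@vert_step X) f); rewrite ?fvert_iter // rotw // ltnW.
  have [ch|ch] := boolP (chirality f); first by exists f; rewrite ?fc ?ch.
  (* Five flips reverse the chirality, and these five bring the word [wc] back at the same
     vertex. *)
  exists (flip2 (flip1 (flip2 (flip1 (flip2 f))))) => //.
  by rewrite !(chirality2, chirality1) !negbK ch !(word1, word2) fc.
Qed.
End Snub.

(** * Case distinction on the vertex type of a toroidal map *)

Import GRing.Theory Num.Theory.

Theorem theorem1 (X : polyhedral_map) (X_toroidal : toroidal X)
    (X_semi_equivelar : semi_equivelar X) :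
  exists (Y : polyhedral_map) (eta : Y -> X),
    [/\ toroidal Y, vertex_transitive Y & covering eta].
Proof.
have [X_or X_euler] := X_toroidal; have [t X_type] := X_semi_equivelar.
have flat : (1 - (size t)%:R / 2 + \sum_(p <- t) p%:R^-1 = 0 :> rat)%R.
  apply/eqP; have /eqP := euler_char_type X_type.
  rewrite X_euler eq_sym mulf_eq0 pnatr_eq0 -leqn0 leqNgt map_nonempty.
  by [].
(* A cover with the same type [t] satisfies the same formula for the Euler characteristic, which
   therefore vanishes. *)
suff [Y [eta [Y_or Y_tr eta_cov Y_type]]] :
  exists (Y : polyhedral_map) (eta : Y -> X),
    [/\ orientable Y, vertex_transitive Y, covering eta &
        forall y : Y, has_vertex_type y t].
  exists Y, eta; split=> //; split=> //; apply/eqP.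
  by rewrite -(intr_eq0 rat) (euler_char_type Y_type) flat mulr0.
have [t3|[u uF tu]] := flat_vertex_type (vertex_type_ge3 X_type) flat.
  have t1 : 1 < size t by rewrite t3.
  apply: (word_label_cover X_type) => // f g.
  by rewrite !(degree3_flip0 X_type t1 t3).
have [tD|] := flat_types_determined uF tu; last by move/snub_cover; apply.
have t1 : 1 < size t.
  have : all (fun u => 1 < size u) flat_types by [].
  by move/allP/(_ u uF); rewrite mem_permutations in tu; rewrite (perm_size tu).
by apply: word_label_cover => // f g; apply: determined_flip0.
Qed.
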